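(* Let $X$ be an oriented rank three nondegenerate WSD manifold, let $\mathcal{L}_{\mathbf 3}$ be the real Lie superalgebra generated by the operators $\imath L_j,\imath V_j,\imath\Lambda_j,A_j$ ($j=0,1,2$), and let $\mathcal{L}_{\mathbf 3,\mathbb C}=\mathcal{L}_{\mathbf 3}\otimes\mathbb C$. Then both $\mathcal{L}_{\mathbf 3}$ and $\mathcal{L}_{\mathbf 3,\mathbb C}$ are closed with respect to the super adjunction operator $\dag$: if $\phi\in\mathcal{L}_{\mathbf 3}$ then $\phi^\dag\in\mathcal{L}_{\mathbf 3}$, and if $\phi\in\mathcal{L}_{\mathbf 3,\mathbb C}$ then $\phi^\dag\in\mathcal{L}_{\mathbf 3,\mathbb C}$. In particular $\mathcal{L}_{\mathbf 3,\mathbb C}$ is a $*$-Lie superalgebra.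
   Context: WSD manifolds. An oriented rank three nondegenerate WSD manifold is an oriented smooth manifold $X$ of dimension $9$ with a Riemannian metric and closed smooth $2$-forms $\omega_1,\omega_2,\omega_D$ such that the distribution $\omega_1^0+\omega_2^0$ is integrable ($\omega_i^0\subset TX$ is the kernel of $\omega_i$), and such that every $T_p^*X$ has an orthonormal basis $v_{ij}$ ($i=1,2,3$, $j=0,1,2$), called an adapted coframe, with $\omega_1=\sum_i v_{i0}\wedge v_{i1}$, $\omega_2=\sum_i v_{i0}\wedge v_{i2}$, $\omega_D=\sum_i v_{i1}\wedge v_{i2}$ at $p$. The spaces $W_j=\mathrm{span}_{\mathbb R}(v_{1j},v_{2j},v_{3j})$ and the identifications $W_0\cong W_1\cong W_2$, $v_{i0}\leftrightarrow v_{i1}\leftrightarrow v_{i2}$, do not depend on the adapted coframe; $W_0\cong W_1\cong W_2$ are oriented so that $T_p^*X=W_0\oplus W_1\oplus W_2$ has the given orientation, and adapted coframes are always chosen with $(v_{1j},v_{2j},v_{3j})$ oriented. Put $Vol(W_j)=v_{1j}\wedge v_{2j}\wedge v_{3j}$. Operators. On complex forms put $L_0=\omega_D\wedge\cdot$, $L_1=-\omega_2\wedge\cdot$, $L_2=\omega_1\wedge\cdot$, $V_j=Vol(W_j)\wedge\cdot$. Let $(\ ,\ )_p$ be the Hermitean inner product on $\bigwedge^*_{\mathbb C}T^*_pX$ induced by the metric (linear in the first variable). For a homogeneous operator $\phi$, $\phi^\star$ is defined by $(\phi(\alpha),\beta)_p=(-1)^{\deg(\phi)\deg(\alpha)}(\alpha,\phi^\star(\beta))_p$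 for homogeneous $\alpha,\beta$. Put $\Lambda_j=L_j^\star$, $A_j=V_j^\star$. Operators form a Lie superalgebra under the supercommutator, with $\mathbb Z/2$-grading induced by parity of the degree of forms. $\mathcal{L}_{\mathbf 3}$ is the real Lie subalgebra of the general linear Lie superalgebra of $\Omega^*_{\mathbb C}(X)$ generated by $\imath L_j,\imath V_j,\imath\Lambda_j,A_j$, $j=0,1,2$; its elements act fibrewise on $\bigwedge^*_{\mathbb C}T^*_pX$. $\mathcal{L}_{\mathbf 3,\mathbb C}=\mathcal{L}_{\mathbf 3}\otimes\mathbb C$ is in a natural way a complex Lie subalgebra of the general linear Lie superalgebra of $\Omega^*_{\mathbb C}(X)$. Super adjunction $\dag$. $\mathcal H=\bigwedge^*_{\mathbb C}T^*_pX$ with $(\ ,\ )=(\ ,\ )_p$ is a super Hilbert space (even and odd degree forms being orthogonal). Put $\langle x,y\rangle=0$ if $x,y$ have opposite parity, $\langle x,y\rangle=(x,y)$ if both are even, $\langle x,y\rangle=\imath(x,y)$ if both are odd. For a homogeneous operator $T$ on $\mathcal H$, $T^\dag$ is defined by $\langle Tx,y\rangle=(-1)^{\deg(T)\deg(x)}\langle x,T^\dag y\rangle$ for homogeneous $x,y$, extended additively. A complex Lie superalgebra of operators closed with respect to $\dag$ is called a $*$-Lie superalgebra. *)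

(* Defs.v *)
From HB Require Import structures.
From mathcomp Require Import all_boot all_order all_algebra.
From mathcomp Require Import all_classical all_reals all_analysis.
From mathcomp Require Import complex.

Set Implicit Arguments.
Unset Strict Implicit.
Unset Printing Implicit Defensive.

Import Order.TTheory GRing.Theory Num.Theory.
Import numFieldNormedType.Exports.

Local Open Scope classical_set_scope.
Local Open Scope ring_scope.

(* The exterior algebra of (K^n)^*: with dx_S := dx_i1 /\ ... /\ dx_ik for
   S = {i1 < ... < ik}, the element a stands for \sum_S a S dx_S. *)
Definition ext (K : comNzRingType) (n : nat) := {ffun {set 'I_n} -> K^o}.

Section ExteriorAlgebra.
Variables (K : comNzRingType) (n : nat).
Implicit Types (a b : ext K n) (S T : {set 'I_n}).

Definition has_degree (k : nat) a := forall S, a S != 0 -> #|S| = k.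

(* parity false is even, true is odd *)
Definition has_parity (b : bool) a := forall S, a S != 0 -> odd #|S| = b.

Definition parity_part (b : bool) a : ext K n :=
  [ffun S : {set 'I_n} => if odd #|S| == b then a S else 0].

Definition covector (v : 'rV[K]_n) : ext K n :=
  [ffun S : {set 'I_n} => \sum_(i | S == [set i]%SET) v 0 i].

Definition inversions S T : nat :=
  #|[set ij : 'I_n * 'I_n |
      [&& ij.1 \in S, ij.2 \in T & (ij.2 < ij.1)%N]]%SET|.

Definition wedge a b : ext K n :=
  [ffun S : {set 'I_n} => \sum_(A in powerset S)
     (-1) ^+ inversions A (S :\: A) * a A * b (S :\: A)].

(* The minor of M with rows S and columns T (0 if they differ in number). *)
Definition minor (M : 'M[K]_n) S T : K :=
  if #|S| == #|T| then
    \det (\matrix_(i < #|S|, j < #|S|)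
            nth 0 [seq M (enum_val i) t | t <- enum T] j)
  else 0.

(* Pullback along v |-> v *m M; it maps dx_T to \sum_S minor M S T dx_S. *)
Definition pullback (M : 'M[K]_n) a : ext K n :=
  [ffun S : {set 'I_n} => \sum_(T : {set 'I_n}) minor M S T * a T].

(* a(v, w) for a of degree 2 *)
Definition eval2 a (v w : 'rV[K]_n) : K :=
  \sum_(i < n) \sum_(j < n | (i < j)%N)
    a [set i; j]%SET * (v 0 i * w 0 j - v 0 j * w 0 i).

Definition kernel2 a : set 'rV[K]_n := [set v | forall w, eval2 a v w = 0].

End ExteriorAlgebra.

Section ComplexExterior.
Variables (R : realType) (n : nat).

Definition complexify (a : ext R n) : ext R[i] n :=
  [ffun S : {set 'I_n} => (a S)%:C%C].

Definition ext_Re (a : ext R[i] n) : ext R n :=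
  [ffun S : {set 'I_n} => complex.Re (a S)].

Definition ext_Im (a : ext R[i] n) : ext R n :=
  [ffun S : {set 'I_n} => complex.Im (a S)].

(* The Hermitean product induced by the metric g on R^n: invmx g is the metric
   on (R^n)^*, and (dx_S, dx_T) is the Gram determinant of the (dx_s, dx_t). *)
Definition hermitian (g : 'M[R]_n) (a b : ext R[i] n) : R[i] :=
  \sum_(S : {set 'I_n}) \sum_(T : {set 'I_n})
    (minor (invmx g) S T)%:C%C * (a S * (b T)^*).

Definition super_hermitian (g : 'M[R]_n) (a b : ext R[i] n) : R[i] :=
  hermitian g (parity_part false a) (parity_part false b)
  + 'i%C * hermitian g (parity_part true a) (parity_part true b).

(* F' is the adjoint F^* (star) of the operator F of degree d; only the parity
   of d matters, so operators of degree -d are covered as well. *)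
Definition star_adjoint (g : 'M[R]_n) (d : nat)
    (F F' : ext R[i] n -> ext R[i] n) : Prop :=
  linear F' /\
  forall (k l : nat) (a b : ext R[i] n), has_degree k a -> has_degree l b ->
    hermitian g (F a) b = (-1) ^+ (d * k) * hermitian g a (F' b).

End ComplexExterior.

Section Superalgebra.
Variables (R : realType) (M : lmodType R[i]) (par : bool -> M -> Prop).
Implicit Types (phi psi : M -> M) (g : set (M -> M)).

Definition op_parity (b : bool) phi : Prop :=
  forall c x, par c x -> par (b (+) c) (phi x).

Definition superbracket (b c : bool) phi psi : M -> M :=
  phi \o psi - (-1) ^+ (b && c) *: (psi \o phi).

(* k is the set of scalars: the real numbers or all of R[i]. The bracket is given
   on homogeneous elements only, which suffices since g is graded. *)
Record Lie_subsuperalgebra (k : set R[i]) g : Prop := LieSubsuperalgebra {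
  lie_linear : forall phi, g phi -> linear phi;
  lie_0 : g 0;
  lie_add : forall phi psi, g phi -> g psi -> g (phi + psi);
  lie_scale : forall c phi, k c -> g phi -> g (c *: phi);
  lie_graded : forall phi, g phi -> exists phi0 phi1,
    [/\ g phi0, g phi1, op_parity false phi0, op_parity true phi1
      & phi = phi0 + phi1];
  lie_bracket : forall b c phi psi, g phi -> g psi ->
    op_parity b phi -> op_parity c psi -> g (superbracket b c phi psi)
}.

Definition real_scalars : set R[i] := range (fun x : R => x%:C%C).

Definition real_Lie_generated (gens : set (M -> M)) : set (M -> M) :=
  smallest (Lie_subsuperalgebra real_scalars) gens.

(* The image in gl(M) of the complexification of g. *)
Definition complexification g : set (M -> M) :=
  [set phi | exists phi1 phi2,
     [/\ g phi1, g phi2 & phi = phi1 + 'i%C *: phi2]].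

End Superalgebra.

Section SuperAdjoint.
Variables (R : realType) (n : nat).
Local Notation H := (ext R[i] n).

Definition homogeneous_super_adjoint (g : 'M[R]_n) (d : bool) (F F' : H -> H) :=
  [/\ linear F, linear F', op_parity (@has_parity _ _) d F
    & forall (b c : bool) (x y : H), has_parity b x -> has_parity c y ->
      super_hermitian g (F x) y
      = (-1) ^+ (d && b) * super_hermitian g x (F' y)].

Definition super_adjoint (g : 'M[R]_n) (F F' : H -> H) : Prop :=
  exists F0 F1 F0' F1' : H -> H,
    [/\ homogeneous_super_adjoint g false F0 F0',
        homogeneous_super_adjoint g true F1 F1',
        F = F0 + F1 & F' = F0' + F1'].

End SuperAdjoint.

Section Smoothness.
Variables (R : realType) (V W : normedModType R).

(* Iterated directional derivatives up to order k exist and are continuous. *)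
Fixpoint Ck_on (k : nat) (U : set V) (f : V -> W) : Prop :=
  (forall x, U x -> {for x, continuous f}) /\
  (if k is k'.+1 then
     forall v, (forall x, U x -> derivable f x v) /\
               Ck_on k' U (fun x => 'D_v f x)
   else True).

(* Meant for U open. *)
Definition smooth_on (U : set V) (f : V -> W) : Prop := forall k, Ck_on k U f.

Lemma eq_on_near (U : set V) (f g : V -> W) x : open U ->
  (forall x, U x -> f x = g x) -> U x -> {near x, f =1 g}.
Proof.
by move=> oU fg Ux; near=> y; apply: fg; near: y; exact: open_nbhs_nbhs.
Unshelve. all: by end_near. Qed.

Lemma eq_continuous_on (U : set V) (f g : V -> W) : open U ->
  (forall x, U x -> f x = g x) -> (forall x, U x -> {for x, continuous f}) ->
  forall x, U x -> {for x, continuous g}.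
Proof.
move=> oU fg cf x Ux; rewrite /continuous_at /prop_for -(fg x Ux).
apply: cvg_trans (cf x Ux); apply: near_eq_cvg.
by have := eq_on_near oU fg Ux; apply: filterS => y /= ->.
Qed.

Lemma eq_Ck_on k (U : set V) (f g : V -> W) : open U ->
  (forall x, U x -> f x = g x) -> Ck_on k U f -> Ck_on k U g.
Proof.
move=> oU; elim: k f g => [|k IH] f g fg [cf Df].
  by split=> // x Ux; exact: (eq_continuous_on oU fg cf).
split=> [x Ux|v]; first exact: (eq_continuous_on oU fg cf).
have [dv Cv] := Df v; split=> [y Uy|].
  exact: near_eq_derivable (eq_on_near oU fg Uy) (dv y Uy).
by apply: IH Cv => y Uy; exact: near_eq_derive (eq_on_near oU fg Uy).
Qed.

Lemma Ck_onD k (U : set V) (f g : V -> W) : open U ->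
  Ck_on k U f -> Ck_on k U g -> Ck_on k U (f + g).
Proof.
move=> oU; elim: k f g => [|k IH] f g [cf Df] [cg Dg]; split=> //.
- by move=> x Ux; apply: continuousD; [exact: cf|exact: cg].
- by move=> x Ux; apply: continuousD; [exact: cf|exact: cg].
- move=> v; have [df Cf] := Df v; have [dg Cg] := Dg v; split=> [x Ux|].
    by apply: derivableD; [exact: df|exact: dg].
  apply: eq_Ck_on (IH _ _ Cf Cg) => // x Ux.
  by rewrite deriveD//; [exact: df|exact: dg].
Qed.

Lemma Ck_onZ k (U : set V) (c : R) (f : V -> W) : open U ->
  Ck_on k U f -> Ck_on k U (c *: f).
Proof.
move=> oU; elim: k f => [|k IH] f [cf Df]; split=> //.
- by move=> x Ux; apply: continuousZr; exact: cf.
- by move=> x Ux; apply: continuousZr; exact: cf.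
- move=> v; have [df Cf] := Df v; split=> [x Ux|].
    by apply: derivableZ; exact: df.
  by apply: eq_Ck_on (IH _ Cf) => // x Ux; rewrite deriveZ//; exact: df.
Qed.

Lemma smooth_onP (U : set V) (c : R) (f g : V -> W) : open U ->
  smooth_on U f -> smooth_on U g -> smooth_on U (c *: f + g).
Proof. by move=> oU sf sg k; apply: Ck_onD => //; apply: Ck_onZ. Qed.

Lemma smooth_on0 (U : set V) : open U -> smooth_on U (0 : V -> W).
Proof.
move=> oU; elim=> [|k IH]; (split=> //; first by move=> x _; exact: cst_continuous).
move=> v; split=> [x _|]; first exact: derivable_cst.
by apply: eq_Ck_on IH => // x _; rewrite derive_cst.
Qed.

End Smoothness.

Section Manifold.
Variables (R : realType) (n : nat).

Record chart (X : topologicalType) := Chart {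
  chart_dom : set X;
  chart_map : X -> 'rV[R]_n;
  chart_inv : 'rV[R]_n -> X;
  chart_cod := chart_map @` chart_dom;
  chart_dom_open : open chart_dom;
  chart_cod_open : open chart_cod;
  chart_mapK : forall p, chart_dom p -> chart_inv (chart_map p) = p;
  chart_map_continuous :
    forall p, chart_dom p -> {for p, continuous chart_map};
  chart_inv_continuous :
    forall x, chart_cod x -> {for x, continuous chart_inv}
}.

(* The orientation is given by an atlas with positive transition Jacobians.
   The preferred chart around p identifies the tangent space at p with the row
   vectors 'rV_n, compatibly with the orientation; tensors at p are expressed in
   the frame of that chart. *)
Record oriented_manifold := OrientedManifold {
  carrier :> topologicalType;
  manifold_hausdorff : hausdorff_space carrier;
  manifold_second_countable : @second_countable carrier;
  atlas : set (chart carrier);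
  chart_at : carrier -> chart carrier;
  chart_at_atlas : forall p, atlas (chart_at p);
  chart_at_dom : forall p, chart_dom (chart_at p) p;
  transition_smooth : forall e f, atlas e -> atlas f ->
    smooth_on (chart_map e @` (chart_dom e `&` chart_dom f))
              (chart_map f \o chart_inv e);
  transition_oriented : forall e f x, atlas e -> atlas f ->
    (chart_map e @` (chart_dom e `&` chart_dom f)) x ->
    0 < \det (jacobian (chart_map f \o chart_inv e) x)
}.

Variable X : oriented_manifold.

(* The matrix of the identification R^n = T_pX given by the chart e, where
   p = chart_inv e x and T_pX is 'rV_n through chart_at p. *)
Definition frame (e : chart X) (x : 'rV[R]_n) : 'M[R]_n :=
  jacobian (chart_map (chart_at (chart_inv e x)) \o chart_inv e) x.

Definition form := X -> ext R n.

Definition local_form (a : form) (e : chart X) (x : 'rV[R]_n) : ext R n :=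
  pullback (frame e x) (a (chart_inv e x)).

Definition smooth_form (a : form) : Prop := forall e S, atlas e ->
  smooth_on (chart_cod e) (fun x => local_form a e x S : R^o).

(* d = \sum_i dx_i /\ d/dx_i *)
Definition exterior_derivative (a : 'rV[R]_n -> ext R n) (x : 'rV[R]_n) :
    ext R n :=
  \sum_(i < n) wedge (covector (delta_mx 0 i))
    [ffun S : {set 'I_n} => 'D_(delta_mx 0 i) (fun y => a y S : R^o) x].

Definition closed_form (a : form) : Prop := forall e x, atlas e ->
  chart_cod e x -> exterior_derivative (local_form a e) x = 0.

Definition local_metric (g : X -> 'M[R]_n) (e : chart X) (x : 'rV[R]_n) :=
  frame e x *m g (chart_inv e x) *m (frame e x)^T.

Record riemannian_metric (g : X -> 'M[R]_n) : Prop := RiemannianMetric {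
  metric_sym : forall p, (g p)^T = g p;
  metric_pos : forall p (v : 'rV[R]_n), v != 0 -> 0 < (v *m g p *m v^T) 0 0;
  metric_smooth : forall e, atlas e ->
    smooth_on (chart_cod e) (local_metric g e)
}.

(* Every point p lies on an integral manifold of D: in the chart at p there is a
   smooth immersion s of an open neighbourhood U of 0 in R^k, with s 0 = p, whose
   tangent space at each point is D. *)
Definition integrable_distribution (D : X -> set 'rV[R]_n) : Prop :=
  forall p, let e := chart_at p in
  exists (k : nat) (U : set 'rV[R]_k) (s : 'rV[R]_k -> 'rV[R]_n),
    [/\ open U, U 0, s 0 = chart_map e p, smooth_on U s
      & forall u, U u ->
        [/\ chart_cod e (s u), row_free (jacobian s u)
          & forall v : 'rV[R]_n, (v <= jacobian s u)%MS <->
              D (chart_inv e (s u)) (v *m frame e (s u))]].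

Definition smooth_complex_form (a : X -> ext R[i] n) : Prop :=
  smooth_form (fun p => ext_Re (a p)) /\ smooth_form (fun p => ext_Im (a p)).

Definition smooth_complex_forms : {pred X -> ext R[i] n} :=
  mem [set a | smooth_complex_form a].

Lemma pullbackP (M : 'M[R]_n) (c : R) (a b : ext R n) :
  pullback M (c *: a + b) = c *: pullback M a + pullback M b.
Proof.
apply/ffunP => S; rewrite !ffunE scaler_sumr -big_split/=.
apply: eq_bigr => T _; rewrite !ffunE mulrDr; congr (_ + _).
by rewrite /GRing.scale/= mulrCA.
Qed.

Lemma ext_linE (c : R) (a b : ext R n) S :
  (c *: a + b) S = c *: a S + b S.
Proof. by rewrite !ffunE. Qed.

Lemma smooth_formP (c : R) (a b : form) :
  smooth_form a -> smooth_form b -> smooth_form (c *: a + b).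
Proof.
move=> sa sb e S he k.
have := smooth_onP c (@chart_cod_open _ e) (sa e S he) (sb e S he) k.
apply: eq_Ck_on; first exact: chart_cod_open.
move=> x _; have := ext_linE c (local_form a e x) (local_form b e x) S.
by rewrite -pullbackP => /esym.
Qed.

Lemma smooth_form0 : smooth_form 0.
Proof.
move=> e S he k; have := @smooth_on0 _ _ R^o _ (@chart_cod_open _ e) k.
apply: eq_Ck_on; first exact: chart_cod_open.
move=> x _; rewrite /local_form [RHS]ffunE big1// => T _.
by rewrite [X in _ * X]ffunE mulr0.
Qed.

Lemma smooth_complex_forms_submod : submod_closed smooth_complex_forms.
Proof.
split=> [|c a b]; rewrite !inE.
  split; have := smooth_form0; congr (smooth_form _); apply/funext => p;
  by apply/ffunP => S; rewrite !ffunE.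
move=> [ra ia] [rb ib]; split.
- have := smooth_formP (complex.Re c) ra (smooth_formP (- complex.Im c) ia rb).
  congr (smooth_form _); apply/funext => p; apply/ffunP => S.
  rewrite !ffunE/= /GRing.scale/=; case: c (a p S) (b p S) => c1 c2 [x y] [u v] /=.
  by rewrite mulNr addrA.
- have := smooth_formP (complex.Re c) ia (smooth_formP (complex.Im c) ra ib).
  congr (smooth_form _); apply/funext => p; apply/ffunP => S.
  rewrite !ffunE/= /GRing.scale/=; case: c (a p S) (b p S) => c1 c2 [x y] [u v] /=.
  by rewrite addrA.
Qed.

HB.instance Definition _ := GRing.isSubmodClosed.Build R[i] (X -> ext R[i] n)
  smooth_complex_forms smooth_complex_forms_submod.

(* Omega^*_C(X) *)
Record Omega := SmoothForm {
  form_of :> X -> ext R[i] n;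
  _ : form_of \in smooth_complex_forms
}.

HB.instance Definition _ := [isSub for form_of].
HB.instance Definition _ := [Choice of Omega by <:].
HB.instance Definition _ := [SubChoice_isSubLmodule of Omega by <:].

Definition Omega_parity (b : bool) (a : Omega) := forall p, has_parity b (a p).

Definition acts_fibrewise (phi : Omega -> Omega)
    (F : X -> ext R[i] n -> ext R[i] n) : Prop :=
  forall a p, phi a p = F p (a p).

Definition super_adjoint_of (g : X -> 'M[R]_n) (phi psi : Omega -> Omega) :=
  exists F F', [/\ acts_fibrewise phi F, acts_fibrewise psi F'
                 & forall p, super_adjoint (g p) (F p) (F' p)].

(* Super adjoints are unique in each fibre, and every vector of a fibre is the
   value of a smooth form: psi is the only possible phi^dagger. *)
Definition dagger_closed (g : X -> 'M[R]_n) (L : set (Omega -> Omega)) :=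
  forall phi, L phi -> exists2 psi, L psi & super_adjoint_of g phi psi.

Definition star_Lie_superalgebra (g : X -> 'M[R]_n) (L : set (Omega -> Omega)) :=
  Lie_subsuperalgebra Omega_parity setT L /\ dagger_closed g L.

End Manifold.

Section WSD.
Variable R : realType.

Section Coframe.
Variables (g : 'M[R]_9) (w1 w2 wD : ext R 9).

(* v i j is the covector v_{i+1,j} *)
Definition adapted_coframe (v : 'I_3 -> 'I_3 -> 'rV[R]_9) : Prop :=
  let e i j := covector (v i j) in
  [/\ forall i j k l, (v i j *m invmx g *m (v k l)^T) 0 0
                      = ((i == k) && (j == l))%:R,
      w1 = \sum_i wedge (e i 0) (e i 1),
      w2 = \sum_i wedge (e i 0) (e i 2)
    & wD = \sum_i wedge (e i 1) (e i 2)].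

(* The basis v_10, v_20, v_30, v_11, ..., v_32 of the cotangent space is
   positive. For an adapted coframe this says that (v_1j, v_2j, v_3j) is
   oriented for every j: these three bases have the same sign s relative to the
   orientations of the W_j, which correspond under W_0 = W_1 = W_2, and the sign
   of the whole basis is s ^+ 3. *)
Definition positive_coframe (v : 'I_3 -> 'I_3 -> 'rV[R]_9) : Prop :=
  0 < \det (\matrix_(r < 9) v (inord (r %% 3)) (inord (r %/ 3))).

Definition Vol (v : 'I_3 -> 'I_3 -> 'rV[R]_9) (j : 'I_3) : ext R 9 :=
  wedge (covector (v 0 j)) (wedge (covector (v 1 j)) (covector (v 2 j))).

End Coframe.

Record WSD3_manifold := WSD3Manifold {
  WSD_space :> oriented_manifold R 9;
  metric : WSD_space -> 'M[R]_9;
  omega1 : form WSD_space;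
  omega2 : form WSD_space;
  omegaD : form WSD_space;
  metric_riemannian : riemannian_metric metric;
  omega_degree : forall p,
    [/\ has_degree 2 (omega1 p), has_degree 2 (omega2 p)
      & has_degree 2 (omegaD p)];
  omega_smooth :
    [/\ smooth_form omega1, smooth_form omega2 & smooth_form omegaD];
  omega_closed :
    [/\ closed_form omega1, closed_form omega2 & closed_form omegaD];
  omega_integrable : integrable_distribution (fun p =>
    [set v + w | v in kernel2 (omega1 p) & w in kernel2 (omega2 p)]);
  WSD_coframe : forall p, exists v,
    adapted_coframe (metric p) (omega1 p) (omega2 p) (omegaD p) v
}.

Variable X : WSD3_manifold.

Definition L_form (j : 'I_3) (p : X) : ext R 9 :=
  tnth [tuple omegaD p; - omega2 p; omega1 p] j.

(* Vol(W_j) at p, computed in a chosen oriented adapted coframe *)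
Definition VolW (j : 'I_3) (p : X) : ext R 9 :=
  Vol (xget (fun _ _ => 0) [set v |
         adapted_coframe (metric p) (omega1 p) (omega2 p) (omegaD p) v
         /\ positive_coframe v]) j.

Definition is_wedge_with (w : form X) (phi : Omega X -> Omega X) : Prop :=
  acts_fibrewise phi (fun p => wedge (complexify (w p))).

(* The adjoint of w /\ - is taken in each fibre, where it is unique. *)
Definition is_star_of_wedge (d : nat) (w : form X)
    (psi : Omega X -> Omega X) : Prop :=
  exists2 F', acts_fibrewise psi F' &
    forall p, star_adjoint (metric p) d (wedge (complexify (w p))) (F' p).

(* The operators are specified by their actions on the fibres, which determine
   them. *)
Record WSD_operators (L V Lam A : 'I_3 -> Omega X -> Omega X) : Prop :=
  WSDOperators {
    op_L : forall j, is_wedge_with (L_form j) (L j);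
    op_V : forall j, is_wedge_with (VolW j) (V j);
    op_Lam : forall j, is_star_of_wedge 2 (L_form j) (Lam j);
    op_A : forall j, is_star_of_wedge 3 (VolW j) (A j)
  }.

Definition L3 (L V Lam A : 'I_3 -> Omega X -> Omega X) :
    set (Omega X -> Omega X) :=
  real_Lie_generated (@Omega_parity _ _ X)
    [set phi | exists j : 'I_3,
       [\/ phi = 'i%C *: L j, phi = 'i%C *: V j, phi = 'i%C *: Lam j
         | phi = A j]].

Definition L3C (L V Lam A : 'I_3 -> Omega X -> Omega X) :
    set (Omega X -> Omega X) :=
  complexification (L3 L V Lam A).

End WSD.

(* Main.v *)
Require Import Defs.
From HB Require Import structures.
From mathcomp Require Import all_boot all_order all_algebra.
From mathcomp Require Import all_classical all_reals all_analysis.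
From mathcomp Require Import complex ring finset.

(** Write T^s for the ordinary adjoint of an operator on a fibre, and eps for
    (-1)^deg. For even T the star and the super adjoint are both T^s. For odd T
    the sign in the definition of the star gives eps T^s, whereas the super
    adjoint is -i T^s ([star_adjointE], [super_adjoint_odd]). Hence, with
    A_j = eps V_j^s,

      (i L_j)^dag = -i Lambda_j,        (i Lambda_j)^dag = -i L_j,
      (i V_j)^dag = - V_j^s,            (A_j)^dag = i eps V_j,

    and neither V_j^s nor i eps V_j is a multiple of a generator. They are
    nevertheless in the real algebra. Let e_ij be the wedge product with v_ij
    and c_ij its adjoint, the contraction by v_ij; these operators satisfy the
    canonical anticommutation relations. With indices j modulo 3,
    L_(j+2) = sum_i e_ij e_i(j+1), so the derivation [., L_(j+2)] sends c_ij
    to e_i(j+1) and kills the latter. Its cube sends the product V_j^s of three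
    contractions to 3! times a product of three wedge products, namely
    -6 V_(j+1); likewise the cube of [., Lambda_(j+2)] sends V_j to
    6 V_(j+1)^s ([ad3_product], [ad3_L_Vstar], [ad3_Lambda_V]). In terms of the
    generators, the triple bracket of i V_j with i Lambda_(j+2) is
    i^4 6 V_(j+1)^s, and that of A_j with i L_(j+2) is i^3 (-6) eps V_(j+1).
    The coefficient is real in the first case and a real multiple of i in the
    second, exactly as needed ([dagger_V], [dagger_A]).

    It remains to pass from generators to the algebra. The super adjoint of
    [phi, psi] is -[phi^dag, psi^dag] ([super_adjoint_bracket]), so the
    elements of the algebra whose homogeneous components have a super adjoint
    in it form a graded subalgebra containing the generators
    ([dagger_stable_Lie]), which is everything. Homogeneous components are
    unique because the even and odd parts of a smooth form are smooth.

    The relation between e_ij and c_ij for the Gram determinant form on the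
    exterior algebra is the Laplace expansion of minors ([minor_expand],
    [herm_wedge]). It also shows that the form is nondegenerate, so that the
    stars Lambda_j and A_j are given by these contractions. *)

Set Implicit Arguments.
Unset Strict Implicit.
Unset Printing Implicit Defensive.

Import Order.TTheory GRing.Theory Num.Theory.

Local Open Scope classical_set_scope.
Local Open Scope ring_scope.

(** * Creation and annihilation operators on the exterior algebra *)

Section CreationAnnihilation.
Variables (K : comNzRingType) (n : nat).
Implicit Types (a b c : ext K n) (S T A : {set 'I_n}) (i j : 'I_n).
Implicit Types (v w : 'rV[K]_n).

(** The sign (-1)^(below i S) moves dx_i to its place in the increasing
    product dx_S. *)
Definition below i S : nat := (\sum_(s in S) (s < i))%N.

Definition create i a : ext K n :=
  [ffun S : {set 'I_n} => if i \in S then (-1) ^+ below i S * a (S :\ i)%SET else 0].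

Definition annihilate i a : ext K n :=
  [ffun S : {set 'I_n} => if i \in S then 0 else (-1) ^+ below i S * a (i |: S)%SET].

Definition contract v a : ext K n := \sum_i v 0 i *: annihilate i a.

Lemma belowU1 i j S : j \notin S ->
  below i (j |: S)%SET = ((j < i) + below i S)%N.
Proof. by move=> jS; rewrite /below big_setU1. Qed.

Lemma belowD1 i j S : j \in S ->
  below i S = ((j < i) + below i (S :\ j)%SET)%N.
Proof. by move=> jS; rewrite /below (big_setD1 j). Qed.

Lemma inversionsE S T : inversions S T = (\sum_(i in S) below i T)%N.
Proof.
rewrite /inversions -sum1_card big_mkcond/= (pair_big_dep _ _ _)/=.
rewrite [RHS]big_mkcond/=; apply: eq_bigr => -[i j] _ /=.
by rewrite inE/=; case: (i \in S) => //; case: (j \in T) => //; case: (j < i)%N.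
Qed.

Lemma create_is_linear i : linear (create i).
Proof.
move=> k a b; apply/ffunP => S; rewrite !ffunE.
case: ifP => _; last by rewrite scaler0 addr0.
by rewrite mulrDr /GRing.scale/= mulrCA.
Qed.
HB.instance Definition _ i :=
  GRing.isLinear.Build K (ext K n) (ext K n) *:%R (create i) (create_is_linear i).

Lemma annihilate_is_linear i : linear (annihilate i).
Proof.
move=> k a b; apply/ffunP => S; rewrite !ffunE.
case: ifP => _; first by rewrite scaler0 addr0.
by rewrite mulrDr /GRing.scale/= mulrCA.
Qed.
HB.instance Definition _ i :=
  GRing.isLinear.Build K (ext K n) (ext K n) *:%R (annihilate i)
    (annihilate_is_linear i).

Lemma contract_is_linear v : linear (contract v).
Proof.
move=> k a b; rewrite /contract scaler_sumr -big_split/=.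
by apply: eq_bigr => i _; rewrite linearP scalerDr !scalerA mulrC.
Qed.
HB.instance Definition _ v :=
  GRing.isLinear.Build K (ext K n) (ext K n) *:%R (contract v)
    (contract_is_linear v).

Lemma wedge_is_linear a : linear (wedge a).
Proof.
move=> k b c; apply/ffunP => S; rewrite !ffunE scaler_sumr -big_split/=.
by apply: eq_bigr => A _; rewrite !ffunE mulrDr /GRing.scale/= mulrCA.
Qed.
HB.instance Definition _ a :=
  GRing.isLinear.Build K (ext K n) (ext K n) *:%R (wedge a) (wedge_is_linear a).

Lemma wedgeDl a b c : wedge (a + b) c = wedge a c + wedge b c.
Proof.
apply/ffunP => S; rewrite !ffunE -big_split/=; apply: eq_bigr => A _.
by rewrite !ffunE mulrDr mulrDl.
Qed.

Lemma wedgeZl k a c : wedge (k *: a) c = k *: wedge a c.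
Proof.
apply/ffunP => S; rewrite !ffunE scaler_sumr; apply: eq_bigr => A _.
by rewrite !ffunE /GRing.scale/= mulrCA !mulrA.
Qed.

Lemma wedge0l c : wedge 0 c = 0.
Proof. by have := wedgeZl 0 0 c; rewrite !scale0r. Qed.

Lemma wedge_suml (I : finType) (F : I -> ext K n) c :
  wedge (\sum_i F i) c = \sum_i wedge (F i) c.
Proof.
apply: (big_ind2 (fun x y => wedge x c = y)) => [|a1 a2 b1 b2 <- <-|//].
  exact: wedge0l.
exact: wedgeDl.
Qed.

Lemma wedge_covector v a : wedge (covector v) a = \sum_i v 0 i *: create i a.
Proof.
apply/ffunP => S; rewrite !ffunE sum_ffunE.
under eq_bigr => A _ do rewrite ffunE mulr_sumr mulr_suml.
rewrite (exchange_big_dep predT)//=; apply: eq_bigr => i _.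
rewrite !ffunE; case: ifPn => iS; last first.
  rewrite scaler0 big_pred0 => // A; apply/negP => /andP[] /[swap] /eqP->.
  by rewrite powersetE sub1set (negPf iS).
rewrite (big_pred1 [set i]%SET) => [|A] /=.
  rewrite inversionsE big_set1 (belowD1 i iS) ltnn.
  by rewrite /GRing.scale/= mulrAC mulrC !mulrA.
by rewrite andbC; case: eqP => //= ->; rewrite powersetE sub1set.
Qed.

(** The shuffle sign of i |: B against C is that of B against C, up to moving
    i past the elements of C. *)
Lemma wedge_create i b c : wedge (create i b) c = create i (wedge b c).
Proof.
apply/ffunP => S; rewrite !ffunE; case: ifPn => iS; last first.
  apply: big1 => A; rewrite powersetE => AS; rewrite ffunE ifN ?mulr0 ?mul0r//.
  by apply: contra iS => /(fintype.subsetP AS).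
rewrite mulr_sumr (bigID (fun A => i \in A))/= [X in _ + X]big1 ?addr0.
  rewrite (reindex_onto (fun B => i |: B)%SET (fun A => A :\ i)%SET) /=; last first.
    by move=> A /andP[_ iA]; rewrite setD1K.
  apply: eq_big => [B|B].
    rewrite !powersetE finset.subUset sub1set iS setU11/= andbT.
    have [iB|iB] := boolP (i \in B).
      rewrite subsetD1 iB !andbF; apply/negP => /andP[_ /eqP BE].
      by move: iB; rewrite -BE !inE eqxx.
    by rewrite setU1K// eqxx andbT subsetD1 iB andbT.
  rewrite !powersetE => /andP[/andP[BS _] /eqP Bi].
  have iB : i \notin B by rewrite -Bi !inE eqxx.
  have {}BS : B \subset S.
    by apply: fintype.subset_trans BS; apply: subsetUr.
  rewrite ffunE setU11 Bi !inversionsE big_setU1//=.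
  have -> : (S :\ i :\: B = S :\: (i |: B))%SET.
    by apply/setP => x; rewrite !inE negb_or andbA andbC -!andbA; do !bool_congr.
  have -> : below i S = (below i B + below i (S :\: (i |: B))%SET)%N.
    rewrite (belowD1 i iS) ltnn add0n /below (big_setID B)/=.
    congr (_ + _)%N; apply: eq_bigl => x; rewrite !inE.
      by rewrite andbC; case: eqVneq => [->|_]; rewrite ?(negPf iB)//;
         case: (boolP (x \in B)) => // /(fintype.subsetP BS) ->.
    by rewrite negb_or andbA andbC -!andbA; do !bool_congr.
  by rewrite (belowU1 _ iB) ltnn add0n !exprD; ring.
by move=> A /andP[_ iA]; rewrite ffunE (negPf iA) mulr0 mul0r.
Qed.

Lemma wedge_covectorA v b c :
  wedge (wedge (covector v) b) c = wedge (covector v) (wedge b c).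
Proof.
rewrite !wedge_covector wedge_suml; apply: eq_bigr => i _.
by rewrite wedgeZl wedge_create.
Qed.

(** Adding i to a set changes the sign of create j exactly when i < j, and for
    i != j just one of i < j and j < i holds. *)
Lemma createC i j a : create i (create j a) = - create j (create i a).
Proof.
apply/ffunP => S; rewrite !ffunE !inE.
have [->|ij] /= := eqVneq i j; first by rewrite mulr0 if_same oppr0.
case: ifP => iS; case: ifP => jS; rewrite ?mulr0 ?oppr0//.
rewrite (belowD1 i jS) (belowD1 j iS) setDDl setUC -setDDl !exprD.
by case: ltngtP ij => [_|_|/val_inj->]; rewrite ?eqxx// => _; ring.
Qed.

Lemma annihilateC i j a :
  annihilate i (annihilate j a) = - annihilate j (annihilate i a).
Proof.
apply/ffunP => S; rewrite !ffunE !inE.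
have [->|ij] /= := eqVneq i j; first by rewrite mulr0 if_same oppr0.
case: ifPn => iS; case: ifPn => jS; rewrite ?mulr0 ?oppr0//.
rewrite (belowU1 i jS) (belowU1 j iS) setUCA !exprD.
by case: ltngtP ij => [_|_|/val_inj->]; rewrite ?eqxx// => _; ring.
Qed.

Lemma annihilate_create i j a :
  annihilate i (create j a) = (i == j)%:R *: a - create j (annihilate i a).
Proof.
apply/ffunP => S; rewrite !ffunE !inE.
have [->|ij] /= := eqVneq i j.
  rewrite /GRing.scale/= mul1r; case: ifPn => jS.
    rewrite setD1K// (belowD1 j jS) ltnn add0n.
    by rewrite mulrA -expr2 sqrr_sign mul1r subrr.
  by rewrite belowU1// ltnn setU1K// mulrA -expr2 sqrr_sign mul1r subr0.
rewrite scale0r add0r.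
case: ifPn => iS; case: ifPn => jS; rewrite ?mulr0 ?oppr0//.
have -> : ((i |: S) :\ j = i |: (S :\ j))%SET.
  apply/setP => x; rewrite !inE; case: (eqVneq x i) => [->|//]; by rewrite ij.
rewrite (belowU1 j iS) (belowD1 i jS) !exprD.
by case: ltngtP ij => [_|_|/val_inj->]; rewrite ?eqxx// => _; ring.
Qed.

Lemma wedge_covectorC v w a :
  wedge (covector v) (wedge (covector w) a) =
  - wedge (covector w) (wedge (covector v) a).
Proof.
rewrite !wedge_covector.
under eq_bigr do rewrite linear_sum scaler_sumr.
under [X in _ = - X]eq_bigr do rewrite linear_sum scaler_sumr.
rewrite exchange_big -sumrN; apply: eq_bigr => i _.
rewrite -sumrN; apply: eq_bigr => j _.
by rewrite !linearZ/= createC !scalerN !scalerA mulrC.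
Qed.

Lemma contractC v w a :
  contract v (contract w a) = - contract w (contract v a).
Proof.
rewrite {1 3}/contract.
under eq_bigr do rewrite linear_sum scaler_sumr.
under [X in _ = - X]eq_bigr do rewrite linear_sum scaler_sumr.
rewrite exchange_big -sumrN; apply: eq_bigr => i _.
rewrite -sumrN; apply: eq_bigr => j _.
by rewrite !linearZ/= annihilateC !scalerN !scalerA mulrC.
Qed.

Lemma contract_wedge v w a :
  contract v (wedge (covector w) a) =
  (\sum_i v 0 i * w 0 i) *: a - wedge (covector w) (contract v a).
Proof.
rewrite !wedge_covector {1}/contract.
under eq_bigr do rewrite linear_sum scaler_sumr.
under [X in _ = _ - X]eq_bigr do rewrite linear_sum scaler_sumr.
rewrite [X in _ - X]exchange_big scaler_suml -sumrB; apply: eq_bigr => i _.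
rewrite (bigD1 i)//= [X in _ - X](bigD1 i)//= opprD addrA.
rewrite !linearZ/= annihilate_create eqxx scale1r.
rewrite !scalerBr !scalerA [w 0 i * _]mulrC; congr (_ + _); first by rewrite scalerN.
rewrite -sumrN; apply: eq_bigr => j ji.
by rewrite !linearZ/= annihilate_create eq_sym (negPf ji) scale0r sub0r
  !scalerN !scalerA mulrC.
Qed.

End CreationAnnihilation.

(** * Laplace expansion of minors *)

Section Minors.
Variables (K : comNzRingType) (n : nat) (M : 'M[K]_n).
Implicit Types (S T A U : {set 'I_n}) (i t : 'I_n) (s : seq 'I_n).

(** Sequences may repeat indices, which makes room for determinants with a
    repeated row. *)
Definition seq_minor (x0 : 'I_n) k s1 s2 : K :=
  \det (\matrix_(i < k, j < k) M (nth x0 s1 i) (nth x0 s2 j)).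

Definition delete_at p s := take p s ++ drop p.+1 s.

Lemma nth_delete_at (x0 : 'I_n) p s j : (p < size s)%N ->
  nth x0 (delete_at p s) j = nth x0 s (bump p j).
Proof.
move=> ps; rewrite /delete_at nth_cat size_take ps /bump.
case: ltnP => [jp|pj]; first by rewrite nth_take ?add0n.
by rewrite nth_drop addSn subnKC.
Qed.

Lemma minorE (x0 : 'I_n) S T : #|S| = #|T| ->
  minor M S T = seq_minor x0 #|S| (enum S) (enum T).
Proof.
move=> ST; rewrite /minor ifT; last exact/eqP.
congr (\det _); apply/matrixP => i j.
by rewrite !mxE (nth_map x0) -?cardE -?ST// (enum_val_nth x0).
Qed.

Lemma minor_eq0 S T : #|S| != #|T| -> minor M S T = 0.
Proof. by rewrite /minor => /negPf->. Qed.

Lemma minor00 : minor M set0 set0 = 1.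
Proof.
rewrite /minor eqxx; have det1 k (N : 'M[K]_k) : k = 0%N -> \det N = 1.
  by move=> k0; subst k; apply: det_mx00.
exact/det1/cards0.
Qed.

Lemma index_sorted_ord i s : sorted (fun x y : 'I_n => (x < y)%N) s -> i \in s ->
  index i s = count (fun x : 'I_n => (x < i)%N) s.
Proof.
elim: s => //= x s IH xs; rewrite inE.
have tr : transitive (fun x y : 'I_n => (x < y)%N) by move=> ? ? ?; apply: ltn_trans.
have /allP/= xmin := order_path_min tr xs.
have [->|ix]/= := eqVneq i x.
  rewrite ltnn add0n => _; apply/esym/eqP; rewrite -leqn0 leqNgt -has_count.
  by apply/hasPn => y /xmin; rewrite -leqNgt => /ltnW.
by move=> is_; rewrite xmin// IH// (path_sorted xs).
Qed.

Lemma index_enum_below i S : i \in S -> index i (enum S) = below i S.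
Proof.
move=> iS; rewrite index_sorted_ord ?mem_enum//; last first.
  rewrite /enum_mem -enumT; apply: sorted_filter.
    by move=> ? ? ?; apply: ltn_trans.
  by have := iota_ltn_sorted 0 n; rewrite -val_enum_ord sorted_map.
rewrite -sum1_count big_mkcond big_enum/= /below.
by apply: eq_bigr => x _; case: (x < i)%N.
Qed.

Lemma enum_setD1 S t : t \in S ->
  enum (S :\ t)%SET = delete_at (index t (enum S)) (enum S).
Proof.
move=> tS; rewrite /delete_at -remE rem_filter ?enum_uniq// /enum_mem.
rewrite -filter_predI; apply: eq_filter => x.
by rewrite !inE.
Qed.

Lemma seq_minor_expand (x0 : 'I_n) k s U p : size s = k.+1 -> #|U| = k.+1 ->
  (p < k.+1)%N ->
  seq_minor x0 k.+1 s (enum U) =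
  \sum_(t in U) (-1) ^+ (p + below t U) * M (nth x0 s p) t
     * seq_minor x0 k (delete_at p s) (enum (U :\ t)%SET).
Proof.
move=> sk Uk pk; rewrite -big_enum (big_nth x0) -cardE Uk big_mkord.
rewrite /seq_minor (expand_det_row _ (Ordinal pk)); apply: eq_bigr => j _.
have jU : (j < size (enum U))%N by rewrite -cardE Uk.
have tU : nth x0 (enum U) j \in U by rewrite -mem_enum mem_nth.
rewrite mxE /cofactor/= -index_enum_below// (index_uniq _ jU) ?enum_uniq//.
rewrite [RHS]mulrAC mulrCA -mulrA; congr (_ * _); rewrite mulrC; congr (_ * _).
congr (\det _); apply/matrixP => r c; rewrite !mxE.
rewrite enum_setD1// (index_uniq _ jU) ?enum_uniq// !nth_delete_at//.
by rewrite sk.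
Qed.

(** Laplace expansion along the row i, glued to the rows A. When i is among
    the rows of A, that row is repeated and the expansion vanishes. *)
Lemma minor_expand i A U :
  \sum_(t in U) (-1) ^+ below t U * M i t * minor M A (U :\ t)%SET =
  if i \in A then 0 else (-1) ^+ below i A * minor M (i |: A)%SET U.
Proof.
have [UA|UA] := eqVneq #|U| #|A|.+1; last first.
  rewrite big1 => [|t tU].
    case: ifPn => // iA; rewrite minor_eq0 ?mulr0//.
    by rewrite cardsU1 iA eq_sym.
  rewrite minor_eq0 ?mulr0//; apply: contra UA.
  by rewrite (cardsD1 t U) tU => /eqP->.
have mE t : t \in U -> minor M A (U :\ t)%SET
    = seq_minor i #|A| (enum A) (enum (U :\ t)%SET).
  move=> tU; apply: minorE; apply/eqP.
  by move/eqP: UA; rewrite (cardsD1 t U) tU add1n eqSS eq_sym.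
case: ifPn => iA.
  have := @seq_minor_expand i #|A| (i :: enum A) U 0.
  rewrite /= -cardE UA => /(_ erefl erefl erefl).
  have iA' : ((index i (enum A)).+1 < #|A|.+1)%N.
    by rewrite ltnS cardE index_mem mem_enum.
  rewrite [LHS](@determinant_alternate _ _ _ ord0 (Ordinal iA'))//; last first.
    by move=> j; rewrite !mxE/= nth_index ?mem_enum.
  move=> E; rewrite [RHS]E; apply: eq_bigr => t tU.
  by rewrite add0n mE// /delete_at take0 drop1.
have iS : i \in (i |: A)%SET by rewrite setU11.
have cS : #|(i |: A)%SET| = #|A|.+1 by rewrite cardsU1 iA.
have iE : index i (enum (i |: A)%SET) = below i A.
  by rewrite index_enum_below// belowU1// ltnn.
have pS : (below i A < #|A|.+1)%N by rewrite -cS -iE cardE index_mem mem_enum.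
rewrite (minorE i) ?cS// (@seq_minor_expand i #|A| _ U _ _ _ pS) -?cardE//.
rewrite mulr_sumr; apply: eq_bigr => t tU.
rewrite mE// -{3 4}iE nth_index ?mem_enum// -enum_setD1// setU1K//.
by rewrite exprD !mulrA -expr2 sqrr_sign mul1r.
Qed.

Lemma minor_sym S T : M^T = M -> minor M S T = minor M T S.
Proof.
move=> Ms; have [ST|ST] := eqVneq #|S| #|T|; last first.
  by rewrite !minor_eq0// eq_sym.
have [x0 _|n0] := pickP 'I_n; last first.
  have e U : U = set0 by apply/setP => x; have := n0 x.
  by rewrite (e S) (e T).
rewrite (minorE x0)// (minorE x0)// -ST /seq_minor -det_tr; congr (\det _).
by apply/matrixP => i j; rewrite !mxE -{1}Ms mxE.
Qed.

End Minors.

(** * The Hermitean product on forms *)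

Section HermitianForm.
Variables (R : realType) (n : nat) (g : 'M[R]_n).
Local Notation H := (ext R[i] n).
Local Notation herm := (@Defs.hermitian R n g).
Local Notation cplx := (map_mx (real_complex R)).
Implicit Types (a b c : H) (S T U A : {set 'I_n}) (i t : 'I_n).
Implicit Types (v w : 'rV[R]_n).

Lemma hermDl a b c : herm (a + b) c = herm a c + herm b c.
Proof.
rewrite /Defs.hermitian -big_split/=; apply: eq_bigr => S _.
rewrite -big_split/=; apply: eq_bigr => T _.
by rewrite !ffunE; ring.
Qed.

Lemma hermZl k a c : herm (k *: a) c = k * herm a c.
Proof.
rewrite /Defs.hermitian mulr_sumr; apply: eq_bigr => S _.
rewrite mulr_sumr; apply: eq_bigr => T _.
by rewrite !ffunE /GRing.scale/=; ring.
Qed.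

Lemma hermDr a b c : herm a (b + c) = herm a b + herm a c.
Proof.
rewrite /Defs.hermitian -big_split/=; apply: eq_bigr => S _.
rewrite -big_split/=; apply: eq_bigr => T _.
by rewrite !ffunE rmorphD; ring.
Qed.

Lemma hermZr k a c : herm a (k *: c) = k^* * herm a c.
Proof.
rewrite /Defs.hermitian mulr_sumr; apply: eq_bigr => S _.
rewrite mulr_sumr; apply: eq_bigr => T _.
by rewrite !ffunE /GRing.scale/= rmorphM; ring.
Qed.

Lemma hermNr a b : herm a (- b) = - herm a b.
Proof. by rewrite -scaleN1r hermZr rmorphN1 mulN1r. Qed.

Lemma hermBr a b c : herm a (b - c) = herm a b - herm a c.
Proof. by rewrite hermDr hermNr. Qed.

Lemma hermBl a b c : herm (a - b) c = herm a c - herm b c.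
Proof. by rewrite hermDl -scaleN1r hermZl mulN1r. Qed.

Lemma herm0l a : herm 0 a = 0.
Proof. by rewrite -(subrr a) hermBl subrr. Qed.

Lemma herm0r a : herm a 0 = 0.
Proof. by rewrite -(subrr a) hermBr subrr. Qed.

Lemma herm_suml (I : finType) (F : I -> H) b :
  herm (\sum_i F i) b = \sum_i herm (F i) b.
Proof.
apply: (big_ind2 (fun x y => herm x b = y)) => [|? ? ? ? <- <-|//].
  exact: herm0l.
exact: hermDl.
Qed.

Lemma herm_sumr (I : finType) (F : I -> H) a :
  herm a (\sum_i F i) = \sum_i herm a (F i).
Proof.
apply: (big_ind2 (fun x y => herm a x = y)) => [|? ? ? ? <- <-|//].
  exact: herm0r.
exact: hermDr.
Qed.

Lemma conj_real (x : R) : (x%:C%C)^* = x%:C%C.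
Proof. exact: conjc_real. Qed.

Lemma conj_sign k : ((-1) ^+ k : R[i])^* = (-1) ^+ k.
Proof. by rewrite rmorphXn rmorphN1. Qed.

Lemma herm_conj a b : g^T = g -> herm b a = (herm a b)^*.
Proof.
move=> gs; rewrite /Defs.hermitian rmorph_sum exchange_big; apply: eq_bigr => S _.
rewrite rmorph_sum; apply: eq_bigr => T _.
rewrite !rmorphM/= conjCK conj_real minor_sym; first by rewrite [b T * _]mulrC.
by rewrite trmx_inv gs.
Qed.

Lemma sum_setU1 (V : nmodType) i (F : {set 'I_n} -> {set 'I_n} -> V) :
  \sum_(S : {set 'I_n} | i \in S) F (S :\ i)%SET S
  = \sum_(A : {set 'I_n} | i \notin A) F A (i |: A)%SET.
Proof.
rewrite (reindex_onto (fun A => i |: A)%SET (fun S => S :\ i)%SET) /=; last first.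
  by move=> S iS; rewrite setD1K.
apply: eq_big => [A|A].
  rewrite setU11/=; apply/eqP/idP => [<-|iA]; first by rewrite !inE eqxx.
  by rewrite setU1K.
by move=> /andP[_ /eqP->].
Qed.

(** With S = i |: A on the left and U = t |: T on the right, the coefficients
    of a A and (b U)^* agree by the Laplace expansion along the row i. *)
Lemma herm_create i a b :
  herm (create i a) b = herm a (contract (cplx (row i (invmx g))) b).
Proof.
rewrite /Defs.hermitian; set G := invmx g.
have -> : \sum_S \sum_T (minor G S T)%:C%C * (create i a S * (b T)^*) =
    \sum_(S : {set 'I_n} | i \in S)
      (-1) ^+ below i (S :\ i)%SET * a (S :\ i)%SET
      * \sum_T (minor G S T)%:C%C * (b T)^*.
  rewrite [RHS]big_mkcond/=; apply: eq_bigr => S _; case: ifPn => iS.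
    rewrite mulr_sumr; apply: eq_bigr => T _.
    by rewrite ffunE iS (belowD1 i iS) ltnn add0n; ring.
  by apply: big1 => T _; rewrite ffunE (negPf iS) mul0r mulr0.
rewrite (sum_setU1 i (fun A S =>
  (-1) ^+ below i A * a A * \sum_T (minor G S T)%:C%C * (b T)^*)).
rewrite big_mkcond/=; apply: eq_bigr => A _.
transitivity (a A * \sum_(U : {set 'I_n})
  (\sum_(t in U) (-1) ^+ below t U * G i t * minor G A (U :\ t)%SET)%:C%C * (b U)^*).
  case: ifPn => iA.
    rewrite [_ * a A]mulrC -mulrA; congr (_ * _); rewrite mulr_sumr; apply: eq_bigr => U _.
    rewrite minor_expand (negPf iA) rmorphM rmorph_sign/=; ring.
  rewrite big1 ?mulr0// => U _.
  by rewrite minor_expand; move: iA; rewrite negbK => ->; rewrite mul0r.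
rewrite mulr_sumr.
transitivity (\sum_t \sum_(U : {set 'I_n} | t \in U)
   a A * ((-1) ^+ below t (U :\ t)%SET * (G i t)%:C%C
     * (minor G A (U :\ t)%SET)%:C%C * (b U)^*)).
  rewrite [RHS](exchange_big_dep predT)//=; apply: eq_bigr => U _.
  rewrite rmorph_sum mulr_suml mulr_sumr; apply: eq_bigr => t tU.
  by rewrite !rmorphM rmorph_sign/= (belowD1 t tU) ltnn.
transitivity (\sum_t \sum_(T : {set 'I_n} | t \notin T)
   a A * ((-1) ^+ below t T * (G i t)%:C%C * (minor G A T)%:C%C * (b (t |: T)%SET)^*)).
  apply: eq_bigr => t _.
  exact: (sum_setU1 t (fun T U => a A *
    ((-1) ^+ below t T * (G i t)%:C%C * (minor G A T)%:C%C * (b U)^*))).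
rewrite (exchange_big_dep predT)//=; apply: eq_bigr => T _.
rewrite /contract sum_ffunE rmorph_sum !mulr_sumr big_mkcond/=; apply: eq_bigr => t _.
rewrite !ffunE !mxE /GRing.scale/=; case: ifPn => tT; last first.
  by rewrite (negPn tT) mulr0 rmorph0 !mulr0.
by rewrite (negPf tT) !rmorphM/= conj_real conj_sign; ring.
Qed.

Lemma herm_wedge v a b :
  herm (wedge (covector (cplx v)) a) b = herm a (contract (cplx (v *m invmx g)) b).
Proof.
rewrite wedge_covector herm_suml.
under eq_bigr do rewrite hermZl herm_create mxE -conj_real.
transitivity (herm a (\sum_i (v 0 i)%:C%C *: contract (cplx (row i (invmx g))) b)).
  rewrite herm_sumr; apply: eq_bigr => i _.
  by rewrite hermZr.
congr (herm a _); rewrite /contract.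
under eq_bigr do rewrite scaler_sumr.
rewrite exchange_big; apply: eq_bigr => t _.
under eq_bigr do rewrite scalerA.
rewrite -scaler_suml !mxE rmorph_sum; congr (_ *: _).
by apply: eq_bigr => i _; rewrite !mxE rmorphM.
Qed.

(** Contractions recover every coefficient of b from its pairings: since g is
    invertible, each annihilation operator is the adjoint of a wedge product. *)
Lemma herm_nondegenerate b : invmx g \in unitmx ->
  (forall a, herm a b = 0) -> b = 0.
Proof.
move=> gu b0; apply/ffunP => S; rewrite [RHS]ffunE.
have [k Sk] : exists k, #|S| = k by exists #|S|.
elim: k S b b0 Sk => [|k IH] S b b0 Sk.
  move/eqP: Sk; rewrite cards_eq0 => /eqP->.
  have := b0 [ffun S => (S == set0)%:R].
  rewrite /Defs.hermitian (bigD1 set0)//= [X in _ + X]big1 ?addr0; last first.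
    by move=> T T0; apply: big1 => U _; rewrite ffunE (negPf T0) mul0r mulr0.
  rewrite (bigD1 set0)//= [X in _ + X]big1 ?addr0; last first.
    move=> T T0; rewrite minor_eq0 ?mul0r// cards0 eq_sym cards_eq0//.
  rewrite minor00 ffunE eqxx !mul1r => /eqP.
  by rewrite conjC_eq0 => /eqP.
have [t tS] : exists t, t \in S by apply/set0Pn; rewrite -card_gt0 Sk.
have := IH (S :\ t)%SET (annihilate t b).
rewrite ffunE setD11 setD1K// => /(_ _ _)/eqP.
rewrite mulf_eq0 signr_eq0/= => E; apply/eqP; apply: E => [a|]; last first.
  by move: Sk; rewrite (cardsD1 t) tS add1n => -[].
have := b0 (wedge (covector (cplx (row t (invmx (invmx g))))) a).
rewrite herm_wedge -row_mul mulVmx// /contract.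
rewrite (bigD1 t)//= !mxE eqxx scale1r big1 ?addr0// => i it.
by rewrite !mxE eq_sym (negPf it) scale0r.
Qed.

End HermitianForm.

(** * Triple brackets of operators *)

Section CubeBracket.
Variables (R : realType) (M : lmodType R[i]).
Implicit Types (f e L : M -> M).

Lemma linD f : linear f -> {morph f : x y / x + y}.
Proof. by move=> fl x y; have := fl 1 x y; rewrite !scale1r. Qed.

Lemma lin0 f : linear f -> f 0 = 0.
Proof. by move=> fl; have := fl (-1) 0 0; rewrite scaler0 addr0 scaleN1r addNr. Qed.

Lemma linZ f c : linear f -> {morph f : x / c *: x}.
Proof. by move=> fl x; have := fl c x 0; rewrite (lin0 fl) !addr0. Qed.

Lemma linN f : linear f -> {morph f : x / - x}.
Proof. by move=> fl x; rewrite -scaleN1r (linZ _ fl) scaleN1r. Qed.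

Lemma linB f : linear f -> {morph f : x y / x - y}.
Proof. by move=> fl x y; rewrite linD// linN. Qed.

Lemma lin_sum (I : finType) (F : I -> M) f : linear f ->
  f (\sum_i F i) = \sum_i f (F i).
Proof. by move=> fl; apply: (big_morph f (linD fl) (lin0 fl)). Qed.

Lemma linear_comp f e : linear f -> linear e -> linear (f \o e).
Proof. by move=> fl el c x y /=; rewrite el fl. Qed.

Lemma linear_add f e : linear f -> linear e -> linear (f + e).
Proof.
by move=> fl el c x y; rewrite !fctE el fl scalerDr addrACA.
Qed.

Lemma linear_scale c f : linear f -> linear (c *: f).
Proof.
by move=> fl d x y; rewrite !fctE fl scalerDr !scalerA mulrC.
Qed.

Lemma linear_opp f : linear f -> linear (- f).
Proof. by move=> fl c x y; rewrite !fctE fl opprD scalerN. Qed.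

Lemma linear_superbracket b c f e :
  linear f -> linear e -> linear (superbracket b c f e).
Proof.
move=> fl el; rewrite /superbracket -scaleN1r.
by apply: linear_add; [|do 2!apply: linear_scale]; apply: linear_comp.
Qed.

Lemma superbracketZ b c k l f e : linear f -> linear e ->
  superbracket b c (k *: f) (l *: e) = (k * l) *: superbracket b c f e.
Proof.
move=> fl el; apply/funext => x; rewrite /superbracket !fctE /= (linZ _ fl) (linZ _ el).
by rewrite scalerBr !scalerA [RHS]addrC [LHS]addrC; congr (- (_ *: _) + _); ring.
Qed.

Lemma superbracketDl b c f f' e : linear e ->
  superbracket b c (f + f') e = superbracket b c f e + superbracket b c f' e.
Proof.
move=> el; apply/funext => x; rewrite /superbracket !fctE /= (linD el).
by rewrite scalerDr opprD addrACA.
Qed.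

Lemma superbracketDr b c f e e' : linear f ->
  superbracket b c f (e + e') = superbracket b c f e + superbracket b c f e'.
Proof.
move=> fl; apply/funext => x; rewrite /superbracket !fctE /= (linD fl).
by rewrite scalerDr opprD addrACA.
Qed.

(** The flags are those of an odd f and an even L. *)
Definition ad3 L f : M -> M :=
  let ad h := superbracket true false h L in ad (ad (ad f)).

Lemma ad3Z k l f L : linear f -> linear L ->
  ad3 (l *: L) (k *: f) = (k * l ^+ 3) *: ad3 L f.
Proof.
move=> fl Ll; rewrite /ad3 !superbracketZ//; try exact: linear_superbracket;
  try exact/linear_superbracket/Ll/linear_superbracket.
by congr (_ *: _); rewrite !exprS expr0; ring.
Qed.

Lemma ad3_comp f e L : linear f -> (forall x, f (L x) = L (f x)) ->
  ad3 L (f \o e) = f \o ad3 L e.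
Proof.
move=> fl fL; have ad h : superbracket true false (f \o h) L
    = f \o superbracket true false h L.
  apply/funext => x; rewrite /superbracket !fctE /= (linB fl) (linZ _ fl).
  by rewrite fL.
by rewrite /ad3 !ad.
Qed.

Definition commutes_to L f f' := forall x, f (L x) = L (f x) + f' x.

Lemma commutes_toE L f f' :
  commutes_to L f f' -> superbracket true false f L = f'.
Proof.
move=> fL; apply/funext => x; rewrite /superbracket !fctE/= fL.
by rewrite expr0 scale1r addrAC subrr add0r.
Qed.

Lemma commutes_to_add L f f' e e' : linear L ->
  commutes_to L f f' -> commutes_to L e e' -> commutes_to L (f + e) (f' + e').
Proof.
by move=> Ll fL eL x; rewrite !fctE fL eL (linD Ll) addrACA.
Qed.

Lemma commutes_to_comp L f f' e e' : linear f ->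
  commutes_to L f f' -> commutes_to L e e' ->
  commutes_to L (f \o e) ((f' \o e) + (f \o e')).
Proof. by move=> fl fL eL x; rewrite !fctE /= eL (linD fl) fL addrA. Qed.

(** The derivation [., L] sends f i to e i and kills e i, so its cube sends a
    product of three of the f i to 3! times the product of the e i. *)
Lemma ad3_product f1 f2 f3 e1 e2 e3 L :
  linear f1 -> linear f2 -> linear e1 -> linear e2 -> linear L ->
  commutes_to L f1 e1 -> commutes_to L f2 e2 -> commutes_to L f3 e3 ->
  commutes_to L e1 0 -> commutes_to L e2 0 -> commutes_to L e3 0 ->
  ad3 L (f1 \o (f2 \o f3)) = 6%:R *: (e1 \o (e2 \o e3)).
Proof.
move=> fl1 fl2 el1 el2 Ll f1L f2L f3L e1L e2L e3L; rewrite /ad3.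
have Dff := commutes_to_comp fl2 f2L f3L.
have Def := commutes_to_comp el2 e2L f3L.
have Dfe := commutes_to_comp fl2 f2L e3L.
have Dee := commutes_to_comp el2 e2L e3L.
have Dff2 := commutes_to_add Ll Def Dfe.
have D1 := commutes_to_comp fl1 f1L Dff.
have D2 := commutes_to_add Ll (commutes_to_comp el1 e1L Dff)
  (commutes_to_comp fl1 f1L Dff2).
rewrite (commutes_toE D1) (commutes_toE D2).
have D0 f : commutes_to L (0 \o f) 0.
  by move=> x; rewrite !fctE /= (lin0 Ll) addr0.
have D0' f : linear f -> commutes_to L (f \o 0) 0.
  by move=> fl x; rewrite !fctE /= (lin0 fl) (lin0 Ll) addr0.
have Dff3 := commutes_to_add Ll (commutes_to_add Ll (D0 f3) Dee)
  (commutes_to_add Ll Dee (D0' _ fl2)).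
have D3 := commutes_to_add Ll
  (commutes_to_add Ll (D0 (f2 \o f3)) (commutes_to_comp el1 e1L Dff2))
  (commutes_to_add Ll (commutes_to_comp el1 e1L Dff2)
     (commutes_to_comp fl1 f1L Dff3)).
rewrite (commutes_toE D3); apply/funext => x; rewrite !fctE /=.
have z y : (0 : M -> M) y = 0 by [].
do 2!rewrite ?z ?(lin0 fl1, lin0 fl2, lin0 el1, lin0 el2, addr0, add0r).
by rewrite (linD el1) scaler_nat !mulrS mulr0n addr0 !addrA.
Qed.

(** The commutator of x with a sum of products p i q i, when x anticommutes
    with the factors up to scalars. *)
Lemma commutes_to_quadratic (I : finType) f (p q : I -> M -> M) (a b : I -> R[i]) :
  linear f -> (forall i, linear (p i)) ->
  (forall i x, f (p i x) = a i *: x - p i (f x)) ->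
  (forall i x, f (q i x) = b i *: x - q i (f x)) ->
  commutes_to (fun x => \sum_i p i (q i x)) f
    (fun x => \sum_i (a i *: q i x - b i *: p i x)).
Proof.
move=> fl pl fp fq x; rewrite (lin_sum _ fl) -big_split/=.
apply: eq_bigr => i _; rewrite fp fq (linB (pl i)) (linZ _ (pl i)).
by rewrite opprB addrCA.
Qed.

Lemma anticommuting_rev3 f1 f2 f3 : linear f1 -> linear f3 ->
  (forall y, f1 (f2 y) = - f2 (f1 y)) -> (forall y, f1 (f3 y) = - f3 (f1 y)) ->
  (forall y, f2 (f3 y) = - f3 (f2 y)) ->
  f1 \o (f2 \o f3) = - (f3 \o (f2 \o f1)).
Proof.
move=> fl1 fl3 f12 f13 f23; apply/funext => x; rewrite !fctE /= f23.
by rewrite (linN fl1) f13 opprK f12 (linN fl3).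
Qed.

Lemma comp3N f1 f2 f3 : linear f1 -> linear f2 ->
  (- f1) \o ((- f2) \o (- f3)) = - (f1 \o (f2 \o f3)).
Proof.
move=> fl1 fl2; apply/funext => x.
change (- f1 (- f2 (- f3 x)) = - f1 (f2 (f3 x))).
by rewrite (linN fl2) opprK.
Qed.

End CubeBracket.

(** * The operators of an orthonormal coframe *)

Section Coframe.
Variables (R : realType) (n : nat) (g : 'M[R]_n) (v : 'I_3 -> 'I_3 -> 'rV[R]_n).
Local Notation H := (ext R[i] n).
Local Notation cplx := (map_mx (real_complex R)).
Hypothesis v_orthonormal : forall i j k l,
  (v i j *m invmx g *m (v k l)^T) 0 0 = ((i == k) && (j == l))%:R.
Implicit Types (i j k l : 'I_3) (x y : H).

Definition cowedge i j : H -> H := wedge (covector (cplx (v i j))).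
Definition cocontract i j : H -> H := contract (cplx (v i j *m invmx g)).

Lemma cowedge_linear i j : linear (cowedge i j).
Proof. exact: linearP. Qed.

Lemma cocontract_linear i j : linear (cocontract i j).
Proof. exact: linearP. Qed.

Lemma cowedgeC i j k l x : cowedge i j (cowedge k l x) = - cowedge k l (cowedge i j x).
Proof. exact: wedge_covectorC. Qed.

Lemma cocontractC i j k l x :
  cocontract i j (cocontract k l x) = - cocontract k l (cocontract i j x).
Proof. exact: contractC. Qed.

Lemma cocontract_cowedge i j k l x : cocontract i j (cowedge k l x) =
  ((i == k) && (j == l))%:R *: x - cowedge k l (cocontract i j x).
Proof.
rewrite /cocontract /cowedge contract_wedge; congr (_ *: _ - _).
have := congr1 (real_complex R) (v_orthonormal i j k l).
rewrite rmorph_nat => <-; rewrite [in RHS]mxE rmorph_sum; apply: eq_bigr => t _.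
by rewrite rmorphM !mxE.
Qed.

Lemma cowedge_cocontract i j k l x : cowedge i j (cocontract k l x) =
  ((i == k) && (j == l))%:R *: x - cocontract k l (cowedge i j x).
Proof.
rewrite cocontract_cowedge [k == i]eq_sym [l == j]eq_sym opprB addrC subrK //.
Qed.

Lemma herm_cowedge i j x y :
  Defs.hermitian g (cowedge i j x) y = Defs.hermitian g x (cocontract i j y).
Proof. exact: herm_wedge. Qed.

(** With indices modulo 3 the order of the two factors accounts for the sign
    of - omega_2. *)
Definition L_op j x : H := \sum_i cowedge i (j + 1) (cowedge i (j + 2) x).
Definition Lambda_op j x : H := \sum_i cocontract i (j + 2) (cocontract i (j + 1) x).
Definition V_op j : H -> H := cowedge 0 j \o (cowedge 1 j \o cowedge 2 j).
Definition Vstar_op j : H -> H := cocontract 2 j \o (cocontract 1 j \o cocontract 0 j).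

Lemma L_op_linear j : linear (L_op j).
Proof.
move=> c x y; rewrite /L_op scaler_sumr -big_split/=; apply: eq_bigr => i _.
by rewrite !cowedge_linear.
Qed.

Lemma Lambda_op_linear j : linear (Lambda_op j).
Proof.
move=> c x y; rewrite /Lambda_op scaler_sumr -big_split/=; apply: eq_bigr => i _.
by rewrite !cocontract_linear.
Qed.

Lemma V_op_linear j : linear (V_op j).
Proof. by do !apply: linear_comp; exact: cowedge_linear. Qed.

Lemma Vstar_op_linear j : linear (Vstar_op j).
Proof. by do !apply: linear_comp; exact: cocontract_linear. Qed.

Lemma herm_L j x y :
  Defs.hermitian g (L_op j x) y = Defs.hermitian g x (Lambda_op j y).
Proof.
rewrite herm_suml herm_sumr; apply: eq_bigr => i _.
by rewrite !herm_cowedge.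
Qed.

Lemma herm_V j x y :
  Defs.hermitian g (V_op j x) y = Defs.hermitian g x (Vstar_op j y).
Proof. by rewrite /V_op /Vstar_op /= !herm_cowedge. Qed.

Lemma ord3D21 j : j + 2 + 1 = j.
Proof. by rewrite -addrA -[RHS]addr0; congr (_ + _); apply: val_inj. Qed.

Lemma ord3D22 j : j + 2 + 2 = j + 1.
Proof. by rewrite -addrA; congr (_ + _); apply: val_inj. Qed.

Lemma ord3_succ_neq j : (j == j + 1) = false.
Proof. by rewrite -subr_eq0 opprD addrA subrr sub0r oppr_eq0. Qed.

Lemma commutes_cowedge_Lambda i j :
  commutes_to (Lambda_op (j + 2)) (cowedge i j) (- cocontract i (j + 1)).
Proof.
move=> x.
have := @commutes_to_quadratic _ _ _ _ _ _ _ _ (cowedge_linear i j)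
  (fun k => cocontract_linear k (j + 2 + 2))
  (fun k => cowedge_cocontract i j k (j + 2 + 2))
  (fun k => cowedge_cocontract i j k (j + 2 + 1)).
move=> /(_ x) => ->; congr (_ + _).
rewrite (bigD1 i)//= big1 ?addr0 => [|k ki].
  rewrite !eqxx ord3D22 ord3D21 eqxx ord3_succ_neq /=.
  by rewrite scale0r sub0r scale1r.
by rewrite eq_sym (negPf ki) /= !scale0r subrr.
Qed.

Lemma commutes_cocontract_L i j :
  commutes_to (L_op (j + 2)) (cocontract i j) (cowedge i (j + 1)).
Proof.
move=> x.
have := @commutes_to_quadratic _ _ _ _ _ _ _ _ (cocontract_linear i j)
  (fun k => cowedge_linear k (j + 2 + 1))
  (fun k => cocontract_cowedge i j k (j + 2 + 1))
  (fun k => cocontract_cowedge i j k (j + 2 + 2)).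
move=> /(_ x) => ->; congr (_ + _).
rewrite (bigD1 i)//= big1 ?addr0 => [|k ki].
  rewrite !eqxx ord3D22 ord3D21 eqxx ord3_succ_neq /=.
  by rewrite scale0r subr0 scale1r.
by rewrite eq_sym (negPf ki) /= !scale0r subrr.
Qed.

Lemma commutes_cowedge_L i j k : commutes_to (L_op k) (cowedge i j) 0.
Proof.
move=> x; rewrite addr0 /L_op (lin_sum _ (cowedge_linear i j)).
by apply: eq_bigr => l _;
  rewrite cowedgeC (cowedgeC i) (linN (cowedge_linear _ _)) opprK.
Qed.

Lemma commutes_cocontract_Lambda i j k :
  commutes_to (Lambda_op k) (- cocontract i j) 0.
Proof.
move=> x; rewrite addr0 !fctE (linN (@Lambda_op_linear k)); congr (- _).
rewrite /Lambda_op (lin_sum _ (cocontract_linear i j)).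
by apply: eq_bigr => l _;
  rewrite cocontractC (cocontractC i) (linN (cocontract_linear _ _)) opprK.
Qed.

(** Bracketing with Lambda_(j+2) turns each wedge factor of V_j into minus the
    contraction by its partner in the next W. *)
Lemma ad3_Lambda_V j :
  ad3 (Lambda_op (j + 2)) (V_op j) = 6%:R *: Vstar_op (j + 1).
Proof.
have el i := cowedge_linear i j; have cl i := cocontract_linear i (j + 1).
have lN i : linear (- cocontract i (j + 1)) by exact: linear_opp.
rewrite (ad3_product (el 0) (el 1) (lN 0) (lN 1) (@Lambda_op_linear _)
  (@commutes_cowedge_Lambda 0 j) (@commutes_cowedge_Lambda 1 j)
  (@commutes_cowedge_Lambda 2 j) (@commutes_cocontract_Lambda 0 (j + 1) _)
  (@commutes_cocontract_Lambda 1 (j + 1) _) (@commutes_cocontract_Lambda 2 (j + 1) _)).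
rewrite (comp3N _ (cl 0) (cl 1)).
by rewrite (anticommuting_rev3 (cl 0) (cl 2) (@cocontractC _ _ _ _)
  (@cocontractC _ _ _ _) (@cocontractC _ _ _ _)) opprK.
Qed.

Lemma ad3_L_Vstar j :
  ad3 (L_op (j + 2)) (Vstar_op j) = - 6%:R *: V_op (j + 1).
Proof.
have cl i := cocontract_linear i j; have el i := cowedge_linear i (j + 1).
rewrite (ad3_product (cl 2) (cl 1) (el 2) (el 1) (@L_op_linear _)
  (@commutes_cocontract_L 2 j) (@commutes_cocontract_L 1 j)
  (@commutes_cocontract_L 0 j) (@commutes_cowedge_L 2 (j + 1) _)
  (@commutes_cowedge_L 1 (j + 1) _) (@commutes_cowedge_L 0 (j + 1) _)).
by rewrite (anticommuting_rev3 (el 2) (el 0) (@cowedgeC _ _ _ _)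
  (@cowedgeC _ _ _ _) (@cowedgeC _ _ _ _)) scalerN -scaleNr.
Qed.

End Coframe.

(** * Stars, parities and super adjoints on a fibre *)

Section StarAndParity.
Variables (R : realType) (n : nat) (g : 'M[R]_n).
Local Notation H := (ext R[i] n).
Local Notation herm := (@Defs.hermitian R n g).
Implicit Types (a b x y : H) (S T : {set 'I_n}) (F : H -> H).

Lemma conj_i : ('i%C : R[i])^* = - 'i%C.
Proof. by apply/eqP; rewrite eq_complex /= oppr0 !eqxx. Qed.

Definition basis_form S : H := [ffun T : {set 'I_n} => (T == S)%:R].

Lemma basis_form_degree S : has_degree #|S| (basis_form S).
Proof. by move=> T; rewrite ffunE; case: (eqVneq T S) => [->//|_]; rewrite eqxx. Qed.

Lemma ext_basis a : a = \sum_S a S *: basis_form S.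
Proof.
apply/ffunP => S; rewrite sum_ffunE (bigD1 S)//= big1 ?addr0.
  by rewrite !ffunE eqxx /GRing.scale/= mulr1.
by move=> T TS; rewrite !ffunE eq_sym (negPf TS) /GRing.scale/= mulr0.
Qed.

Definition degree_sign (d : nat) a : H :=
  [ffun S : {set 'I_n} => (-1) ^+ (d * #|S|) * a S].

Lemma degree_sign_linear d : linear (degree_sign d).
Proof.
by move=> c a b; apply/ffunP => S; rewrite !ffunE mulrDr /GRing.scale/= mulrCA.
Qed.

Lemma degree_sign_even d a : ~~ odd d -> degree_sign d a = a.
Proof.
move=> d0; apply/ffunP => S.
by rewrite ffunE -signr_odd oddM (negPf d0) expr0 mul1r.
Qed.

Lemma degree_sign_basis d S :
  degree_sign d (basis_form S) = (-1) ^+ (d * #|S|) *: basis_form S.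
Proof.
apply/ffunP => T; rewrite !ffunE /GRing.scale/=.
by case: eqVneq => [->//|_]; rewrite !mulr0.
Qed.

Lemma herm_degree_sign d a b : herm (degree_sign d a) b = herm a (degree_sign d b).
Proof.
rewrite /Defs.hermitian; apply: eq_bigr => S _; apply: eq_bigr => T _.
have [ST|ST] := eqVneq #|S| #|T|; last by rewrite minor_eq0// !mul0r.
by rewrite !ffunE ST rmorphM rmorphXn rmorphN1/=; ring.
Qed.

(** The sign in the definition of the star makes it differ from the ordinary
    adjoint by (-1)^deg on operators of odd degree. *)
Lemma star_adjointE d F Fs F' : invmx g \in unitmx -> linear Fs ->
  (forall x y, herm (F x) y = herm x (Fs y)) -> star_adjoint g d F F' ->
  F' = degree_sign d \o Fs.
Proof.
move=> gu Fl FFs [F'l FF']; apply/funext => b.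
rewrite [b]ext_basis (lin_sum _ F'l) /= (lin_sum _ Fl).
rewrite (lin_sum _ (@degree_sign_linear d)); apply: eq_bigr => T _.
rewrite (linZ _ F'l) (linZ _ Fl) (linZ _ (@degree_sign_linear d)); congr (_ *: _).
apply/eqP; rewrite -subr_eq0; apply/eqP/(herm_nondegenerate gu) => a.
rewrite [a]ext_basis herm_suml big1// => S _; rewrite hermZl hermBr.
have := FF' _ _ _ _ (@basis_form_degree S) (@basis_form_degree T).
rewrite FFs => /(congr1 ( *%R ((-1) ^+ (d * #|S|)))).
rewrite mulrA -expr2 sqrr_sign mul1r => <-.
rewrite -herm_degree_sign degree_sign_basis hermZl subrr mulr0 //.
Qed.

Local Notation par := (@has_parity R[i] n).

Lemma has_parity0 (b : bool) : par b 0.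
Proof. by move=> S; rewrite ffunE eqxx. Qed.

Lemma has_parityD (b : bool) x y : par b x -> par b y -> par b (x + y).
Proof.
move=> xb yb S; rewrite ffunE => xy.
by have [x0|/xb//] := eqVneq (x S) 0; apply: yb; move: xy; rewrite x0 add0r.
Qed.

Lemma has_parityZ (b : bool) c x : par b x -> par b (c *: x).
Proof.
move=> xb S; rewrite ffunE /GRing.scale/= => cx; apply: xb.
by apply: contra_neq cx => ->; rewrite mulr0.
Qed.

Lemma has_parityN (b : bool) x : par b x -> par b (- x).
Proof. by move=> xb; rewrite -scaleN1r; apply: has_parityZ. Qed.

Lemma has_parity_sum (b : bool) (I : finType) (f : I -> H) :
  (forall i, par b (f i)) -> par b (\sum_i f i).
Proof.
move=> fb; apply: (big_ind (par b)) => //; first exact: has_parity0.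
by move=> *; apply: has_parityD.
Qed.

Lemma parity_partE (b : bool) x : par b x -> parity_part b x = x.
Proof.
move=> xb; apply/ffunP => S; rewrite ffunE; case: eqP => // Sb.
by apply/esym/eqP; apply: contraT => /xb.
Qed.

Lemma parity_part0 (b : bool) x : par (~~ b) x -> parity_part b x = 0.
Proof.
move=> xb; apply/ffunP => S; rewrite !ffunE; case: eqP => // Sb.
by apply/eqP; apply: contraT => /xb; rewrite Sb; case: b {xb Sb}.
Qed.

Lemma op_parity_comp (b c : bool) F F' : op_parity par b F -> op_parity par c F' ->
  op_parity par (b (+) c) (F \o F').
Proof. by move=> Fb Fc d x xd; rewrite -addbA; apply/Fb/Fc. Qed.

Lemma op_parityZ (b : bool) c F : op_parity par b F -> op_parity par b (c *: F).
Proof. by move=> Fb d x xd; apply/has_parityZ/Fb. Qed.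

Lemma op_parityD (b : bool) F F' : op_parity par b F -> op_parity par b F' ->
  op_parity par b (F + F').
Proof. by move=> Fb Fb' d x xd; apply/has_parityD/Fb'/xd/Fb. Qed.

(** On an operator of parity b, (-1)^deg can be moved across at the cost of
    the sign (-1)^b. *)
Lemma degree_sign_op d (b : bool) F a : odd d -> linear F -> op_parity par b F ->
  degree_sign d (F a) = (-1) ^+ b *: F (degree_sign d a).
Proof.
move=> d1 Fl Fb.
have signE (c : bool) x : par c x -> degree_sign d x = (-1) ^+ c *: x.
  move=> xc; apply/ffunP => S; rewrite !ffunE -signr_odd oddM d1 /=.
  by have [->|/xc->//] := eqVneq (x S) 0; rewrite scaler0 mulr0.
have basisP S : par (odd #|S|) (basis_form S).
  by move=> T /basis_form_degree->.
rewrite [a]ext_basis (lin_sum _ (@degree_sign_linear d)) !(lin_sum _ Fl).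
rewrite (lin_sum _ (@degree_sign_linear d)) scaler_sumr; apply: eq_bigr => S _.
rewrite (linZ _ (@degree_sign_linear d)) !(linZ _ Fl) (linZ _ (@degree_sign_linear d)).
rewrite (signE _ _ (basisP S)) (signE _ _ (Fb _ _ (basisP S))) (linZ _ Fl).
by rewrite !scalerA signr_addb mulrCA !mulrA.
Qed.

Lemma wedge_covector_odd v : op_parity par true (wedge (covector v)).
Proof.
move=> c x xc; rewrite wedge_covector; apply: has_parity_sum => i.
apply: has_parityZ => S; rewrite ffunE; case: ifP => [iS|]; last by rewrite eqxx.
rewrite mulf_eq0 signr_eq0 => /xc Sc.
by rewrite (cardsD1 i) iS oddD Sc.
Qed.

Lemma contract_odd v : op_parity par true (contract v).
Proof.
move=> c x xc; apply: has_parity_sum => i; apply: has_parityZ => S.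
rewrite ffunE; case: ifPn => [|iS]; first by rewrite eqxx.
rewrite mulf_eq0 signr_eq0 => /xc <-.
by rewrite cardsU1 iS oddD; case: (odd #|S|).
Qed.

Lemma degree_sign_parity d : op_parity par false (degree_sign d).
Proof.
move=> c x xc S; rewrite ffunE mulf_eq0 signr_eq0; exact: xc.
Qed.

Lemma super_hermitianE (b c : bool) x y : par b x -> par c y ->
  super_hermitian g x y = (b == c)%:R * (if b then 'i%C else 1) * herm x y.
Proof.
rewrite /super_hermitian; case: b c => -[] xb yc.
- rewrite (parity_partE xb) (parity_partE yc) (@parity_part0 false _ xb).
  by rewrite herm0l add0r mul1r.
- rewrite (@parity_part0 false _ xb) (@parity_part0 true _ yc).
  by rewrite herm0l herm0r mulr0 addr0 mul0r mul0r.
- rewrite (@parity_part0 true _ xb) (@parity_part0 false _ yc).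
  by rewrite herm0l herm0r mulr0 addr0 mul0r mul0r.
rewrite (parity_partE xb) (parity_partE yc) (@parity_part0 true _ xb).
by rewrite herm0l mulr0 addr0 !mul1r.
Qed.

Lemma super_adjoint_even F Fs : linear F -> linear Fs ->
  op_parity par false F -> op_parity par false Fs ->
  (forall x y, herm (F x) y = herm x (Fs y)) ->
  homogeneous_super_adjoint g false F Fs.
Proof.
move=> Fl Fsl Fe Fse FFs; split=> // b c x y xb yc.
rewrite expr0 mul1r (super_hermitianE (Fe _ _ xb) yc).
by rewrite (super_hermitianE xb (Fse _ _ yc)) FFs.
Qed.

(** The factor i in the super Hermitean form on odd vectors turns the ordinary
    adjoint of an odd operator into -i times it. *)
Lemma super_adjoint_odd F Fs : linear F -> linear Fs ->
  op_parity par true F -> op_parity par true Fs ->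
  (forall x y, herm (F x) y = herm x (Fs y)) ->
  homogeneous_super_adjoint g true F (- 'i%C *: Fs).
Proof.
move=> Fl Fsl Fe Fse FFs; split=> //; first exact: linear_scale.
move=> b c x y xb yc; rewrite (super_hermitianE (Fe _ _ xb) yc).
rewrite (super_hermitianE xb (op_parityZ (c := - 'i%C) Fse yc)) FFs.
have -> : herm x ((- 'i%C *: Fs) y) = 'i%C * herm x (Fs y).
  by rewrite hermZr rmorphN/= conj_i opprK.
case: b c {xb yc} => -[] /=; rewrite ?mul0r ?mulr0 ?expr0 ?expr1 ?mul1r //.
by rewrite [in RHS]mulrA -expr2 sqr_i mulN1r mulN1r opprK.
Qed.

End StarAndParity.

(** * Graded Lie algebras of operators *)

Section LieSubsuperalgebras.
Variables (R : realType) (M : lmodType R[i]) (par : bool -> M -> Prop).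
Hypothesis par0 : forall b, par b 0.
Hypothesis parP : forall b k x y, par b x -> par b y -> par b (k *: x + y).
Hypothesis par_disjoint : forall x, par false x -> par true x -> x = 0.
Hypothesis par_sum : forall x, exists x0 x1,
  [/\ par false x0, par true x1 & x = x0 + x1].
Implicit Types (phi psi : M -> M) (g gens : set (M -> M)) (k : set R[i]).

Lemma op_parityP b c phi psi : op_parity par b phi -> op_parity par b psi ->
  op_parity par b (c *: phi + psi).
Proof. by move=> fb eb d x xd; apply/parP/eb/xd/fb. Qed.

Lemma op_parity0 b : op_parity par b 0.
Proof. by move=> c x _; apply: par0. Qed.

Lemma op_parity_add b phi psi : op_parity par b phi -> op_parity par b psi ->
  op_parity par b (phi + psi).
Proof. by rewrite -[phi in X in _ -> _ -> X]scale1r; apply: op_parityP. Qed.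

Lemma op_parity_scale b c phi : op_parity par b phi -> op_parity par b (c *: phi).
Proof. by move=> fb; rewrite -[_ *: _]addr0; apply/op_parityP/op_parity0. Qed.

Lemma op_parity_sub b phi psi : op_parity par b phi -> op_parity par b psi ->
  op_parity par b (phi - psi).
Proof.
by move=> fb eb; rewrite -scaleN1r; apply/op_parity_add/op_parity_scale.
Qed.

Lemma op_parity_superbracket b c phi psi :
  op_parity par b phi -> op_parity par c psi ->
  op_parity par (b (+) c) (superbracket b c phi psi).
Proof.
move=> fb ec; apply: op_parity_sub => [d x xd|].
  by rewrite -addbA; apply/fb/ec.
by apply: op_parity_scale => d x xd; rewrite [b (+) c]addbC -addbA; apply/ec/fb.
Qed.

Lemma op_parity_ad3 phi psi : op_parity par true phi -> op_parity par false psi ->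
  op_parity par true (ad3 psi phi).
Proof.
move=> fo pe; have odd f : op_parity par true f ->
    op_parity par true (superbracket true false f psi).
  by move=> /op_parity_superbracket/(_ pe).
exact/odd/odd/odd.
Qed.

(** An operator that both preserves and exchanges the parities kills even and
    odd vectors, hence everything. *)
Lemma op_parity_both b phi : linear phi ->
  op_parity par b phi -> op_parity par (~~ b) phi -> phi = 0.
Proof.
move=> fl fb fb'; apply/funext => x; have [x0 [x1 [e0 e1 ->]]] := par_sum x.
have z c y : par c y -> phi y = 0.
  move=> yc; have := fb _ _ yc; have := fb' _ _ yc.
  by case: b {fb fb'} c {yc} => -[] /= *; apply: par_disjoint.
by rewrite (linD fl) (z _ _ e0) (z _ _ e1) addr0.
Qed.

Lemma graded_unique phi0 phi1 psi0 psi1 :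
  linear phi0 -> linear psi0 ->
  op_parity par false phi0 -> op_parity par true phi1 ->
  op_parity par false psi0 -> op_parity par true psi1 ->
  phi0 + phi1 = psi0 + psi1 -> phi0 = psi0 /\ phi1 = psi1.
Proof.
move=> fl0 el0 f0 f1 e0 e1 E.
have E' : phi0 - psi0 = psi1 - phi1.
  by apply/eqP; rewrite subr_eq addrAC [psi1 + _]addrC -E addrK.
have /eqP : phi0 - psi0 = 0.
  apply: (@op_parity_both false); first exact/linear_add/linear_opp.
    exact: op_parity_sub.
  by rewrite E'; apply: op_parity_sub.
rewrite subr_eq0 => /eqP E0; split=> //.
by move: E; rewrite E0 => /addrI.
Qed.

Lemma homogeneous_component b phi phi0 phi1 :
  linear phi -> linear phi0 -> linear phi1 -> op_parity par b phi ->
  op_parity par false phi0 -> op_parity par true phi1 -> phi = phi0 + phi1 ->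
  phi = if b then phi1 else phi0.
Proof.
move=> fl l0 l1 fb f0 f1 E; have l00 : linear (0 : M -> M).
  by move=> c x y; rewrite scaler0 addr0.
case: b fb => fb.
  by have [_ ->] : 0 = phi0 /\ phi = phi1
    by apply: graded_unique; rewrite ?add0r//; apply: op_parity0.
by have [-> _] : phi = phi0 /\ 0 = phi1
  by apply: graded_unique; rewrite ?addr0//; apply: op_parity0.
Qed.

Definition graded_operators : set (M -> M) := [set phi | exists phi0 phi1,
  [/\ linear phi0, linear phi1, op_parity par false phi0, op_parity par true phi1
    & phi = phi0 + phi1]].

Lemma graded_homogeneous b phi :
  linear phi -> op_parity par b phi -> graded_operators phi.
Proof.
have l0 : linear (0 : M -> M) by move=> c x y; rewrite scaler0 addr0.
move=> fl fb; case: b fb => fb; [exists 0, phi | exists phi, 0]; split=> //;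
  by [exact: op_parity0 | rewrite ?add0r ?addr0].
Qed.

Lemma graded_operators_Lie k : Lie_subsuperalgebra par k graded_operators.
Proof.
have lin phi : graded_operators phi -> linear phi.
  by move=> [f0 [f1 [l0 l1 _ _ ->]]]; apply: linear_add.
split=> //.
- apply: (@graded_homogeneous false); last exact: op_parity0.
  by move=> c x y; rewrite scaler0 addr0.
- move=> phi psi [f0 [f1 [lf0 lf1 pf0 pf1 ->]]] [e0 [e1 [le0 le1 pe0 pe1 ->]]].
  exists (f0 + e0), (f1 + e1); split; try exact: linear_add;
    try exact: op_parity_add.
  by rewrite addrACA.
- move=> c phi _ [f0 [f1 [lf0 lf1 pf0 pf1 ->]]].
  exists (c *: f0), (c *: f1); split; try exact: linear_scale;
    try exact: op_parity_scale.
  by rewrite scalerDr.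
- move=> phi [f0 [f1 [lf0 lf1 pf0 pf1 ->]]]; exists f0, f1; split=> //.
    exact: graded_homogeneous pf0.
  exact: graded_homogeneous pf1.
- move=> b c phi psi fg eg fb ec.
  apply: (@graded_homogeneous (b (+) c)); last exact: op_parity_superbracket.
  by apply: linear_superbracket; apply: lin.
Qed.

(** The homogeneous components of an operator are unique, so they belong to
    every graded algebra that contains it, hence to the intersection. *)
Lemma smallest_Lie k gens : gens `<=` graded_operators ->
  Lie_subsuperalgebra par k (smallest (Lie_subsuperalgebra par k) gens).
Proof.
move=> gensG; have GL := graded_operators_Lie k.
have lin phi : smallest (Lie_subsuperalgebra par k) gens phi -> linear phi.
  by move=> /(_ _ (conj GL gensG)); apply: lie_linear GL _.
split=> //.
- by move=> A [AL _]; apply: lie_0 AL.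
- by move=> phi psi fA eA A AL; apply: (lie_add AL.1); [apply: fA|apply: eA].
- by move=> c phi kc fA A AL; apply: (lie_scale AL.1 kc); apply: fA.
- move=> phi fA; have [f0 [f1 [lf0 lf1 pf0 pf1 E]]] := fA _ (conj GL gensG).
  have comp A : Lie_subsuperalgebra par k A -> gens `<=` A -> A f0 /\ A f1.
    move=> AL gA; have [e0 [e1 [Ae0 Ae1 pe0 pe1 E']]] := lie_graded AL (fA _ (conj AL gA)).
    have [->->//] : f0 = e0 /\ f1 = e1.
    by apply: graded_unique; rewrite -?E//; apply: lie_linear AL _ _.
  exists f0, f1; split=> // A [AL gA]; by have [] := comp A AL gA.
- move=> b c phi psi fA eA fb ec A AL.
  by apply: (lie_bracket AL.1) => //; [apply: fA|apply: eA].
Qed.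

(** The homogeneous components of phi1 + i phi2 are the sums of those of phi1
    and i phi2, so the bracket of homogeneous elements reduces to brackets in g. *)
Lemma complexification_Lie g : Lie_subsuperalgebra par (@real_scalars R) g ->
  Lie_subsuperalgebra par classical_sets.setT (complexification g).
Proof.
move=> gL.
have gZ (r : R) phi : g phi -> g (r%:C%C *: phi).
  by move=> gf; apply: (lie_scale gL) => //; exists r.
have gN phi : g phi -> g (- phi).
  by move=> gf; rewrite -scaleN1r; have := gZ (-1) _ gf; rewrite rmorphN1.
have lin phi : complexification g phi -> linear phi.
  move=> [f1 [f2 [g1 g2 ->]]].
  by apply/linear_add/linear_scale/(lie_linear gL)/g2/(lie_linear gL g1).
have gD := lie_add gL; have g0 := lie_0 gL.
split=> //.
- by exists 0, 0; rewrite scaler0 addr0.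
- move=> phi psi [f1 [f2 [gf1 gf2 ->]]] [e1 [e2 [ge1 ge2 ->]]].
  exists (f1 + e1), (f2 + e2); split; try exact: gD.
  by rewrite scalerDr addrACA.
- move=> c phi _ [f1 [f2 [gf1 gf2 ->]]].
  exists ((complex.Re c)%:C%C *: f1 - (complex.Im c)%:C%C *: f2),
    ((complex.Re c)%:C%C *: f2 + (complex.Im c)%:C%C *: f1).
  split; try by do ?[apply: gD | apply: gN | apply: gZ].
  rewrite {1}[c]complexE !scalerDr !scalerDl !scalerA.
  have -> : 'i%C * (complex.Im c)%:C%C * 'i%C = - (complex.Im c)%:C%C :> R[i].
    by rewrite mulrAC -expr2 sqr_i mulN1r.
  rewrite scaleNr [_ * 'i%C]mulrC addrACA [RHS]addrACA; congr (_ + _).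
  exact: addrC.
- move=> phi [f1 [f2 [gf1 gf2 ->]]].
  have [a0 [a1 [ga0 ga1 pa0 pa1 ->]]] := lie_graded gL gf1.
  have [b0 [b1 [gb0 gb1 pb0 pb1 ->]]] := lie_graded gL gf2.
  exists (a0 + 'i%C *: b0), (a1 + 'i%C *: b1); split.
  + by exists a0, b0.
  + by exists a1, b1.
  + exact/op_parity_add/op_parity_scale.
  + exact/op_parity_add/op_parity_scale.
  + by rewrite scalerDr addrACA.
have hom b phi : complexification g phi -> op_parity par b phi ->
    exists f1 f2, [/\ g f1, g f2, op_parity par b f1, op_parity par b f2
      & phi = f1 + 'i%C *: f2].
  move=> fC fb; have [f1 [f2 [gf1 gf2 E]]] := fC.
  have [a0 [a1 [ga0 ga1 pa0 pa1 Ea]]] := lie_graded gL gf1.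
  have [b0 [b1 [gb0 gb1 pb0 pb1 Eb]]] := lie_graded gL gf2.
  have lc a e : g a -> g e -> linear (a + 'i%C *: e) by move=> ga ge; apply: lin; exists a, e.
  have := @homogeneous_component b phi (a0 + 'i%C *: b0) (a1 + 'i%C *: b1)
    (lin _ fC) (lc _ _ ga0 gb0) (lc _ _ ga1 gb1) fb.
  move=> /(_ _ _ _)E'.
  have {}E' : phi = if b then a1 + 'i%C *: b1 else a0 + 'i%C *: b0.
    apply: E'; try exact/op_parity_add/op_parity_scale.
    by rewrite E Ea Eb scalerDr addrACA.
  by case: b fb E' => fb E'; [exists a1, b1 | exists a0, b0].
move=> b c phi psi fC eC fb ec.
have [f1 [f2 [gf1 gf2 pf1 pf2 ->]]] := hom _ _ fC fb.
have [e1 [e2 [ge1 ge2 pe1 pe2 ->]]] := hom _ _ eC ec.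
have gB x y := lie_bracket gL (b := b) (c := c) (phi := x) (psi := y).
exists (superbracket b c f1 e1 - superbracket b c f2 e2),
  (superbracket b c f1 e2 + superbracket b c f2 e1).
split; try by do ?[apply: gD | apply: gN | apply: gB].
have ll := lie_linear gL; have lZ f : g f -> linear ('i%C *: f).
  by move=> gf; apply/linear_scale/ll.
have sZl f e : g f -> g e ->
    superbracket b c ('i%C *: f) e = 'i%C *: superbracket b c f e.
  by move=> gf ge; rewrite -[e in LHS]scale1r superbracketZ ?mulr1//; apply: ll.
have sZr f e : g f -> g e ->
    superbracket b c f ('i%C *: e) = 'i%C *: superbracket b c f e.
  by move=> gf ge; rewrite -[f in LHS]scale1r superbracketZ ?mul1r//; apply: ll.
rewrite superbracketDl; last by apply: linear_add; [exact: ll|exact: lZ].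
rewrite !superbracketDr; [|exact: lZ|exact: ll].
rewrite (sZr _ _ gf1 ge2) (sZl _ _ gf2 ge1) superbracketZ; [|exact: ll|exact: ll].
rewrite -expr2 sqr_i scaleN1r [in RHS]scalerDr [RHS]addrACA; congr (_ + _).
exact: addrC.
Qed.

End LieSubsuperalgebras.

(** * Super adjoints and superbrackets *)

Section FibreSuperAdjoint.
Variables (R : realType) (n : nat) (g : 'M[R]_n).
Local Notation H := (ext R[i] n).
Local Notation sherm := (@super_hermitian R n g).
Local Notation par := (@has_parity R[i] n).
Implicit Types (x y z : H) (F G : H -> H) (b c d : bool).

Lemma parity_part_linear b : linear (@parity_part R[i] n b).
Proof.
move=> c x y; apply/ffunP => S; rewrite !ffunE.
by case: ifP => _; rewrite ?scaler0 ?addr0.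
Qed.

Lemma parity_partD b x y :
  parity_part b (x + y) = parity_part b x + parity_part b y.
Proof. exact: linD (@parity_part_linear b) x y. Qed.

Lemma parity_partZ b k x : parity_part b (k *: x) = k *: parity_part b x.
Proof. exact: linZ k (@parity_part_linear b) x. Qed.

Lemma shermDl x y z : sherm (x + y) z = sherm x z + sherm y z.
Proof.
rewrite /super_hermitian (parity_partD false) (parity_partD true) !hermDl mulrDr.
exact: addrACA.
Qed.

Lemma shermDr x y z : sherm x (y + z) = sherm x y + sherm x z.
Proof.
rewrite /super_hermitian (parity_partD false) (parity_partD true) !hermDr mulrDr.
exact: addrACA.
Qed.

Lemma shermZl k x z : sherm (k *: x) z = k * sherm x z.
Proof.
rewrite /super_hermitian (parity_partZ false k) (parity_partZ true k)
  (hermZl _ _ (parity_part false x))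
  (hermZl _ _ (parity_part true x)).
by rewrite mulrDr; congr (_ + _); exact: mulrCA.
Qed.

Lemma shermZr k x z : sherm x (k *: z) = k^* * sherm x z.
Proof.
rewrite /super_hermitian (parity_partZ false k) (parity_partZ true k)
  (hermZr _ _ _ (parity_part false z))
  (hermZr _ _ _ (parity_part true z)).
by rewrite mulrDr; congr (_ + _); exact: mulrCA.
Qed.

Local Notation adj := (homogeneous_super_adjoint g).

Lemma has_parityP b k x y : par b x -> par b y -> par b (k *: x + y).
Proof. by move=> xb yb; apply/has_parityD/yb/has_parityZ. Qed.

Lemma super_adjoint0 b : adj b 0 0.
Proof.
have l0 : linear (0 : H -> H) by move=> c x y; rewrite scaler0 addr0.
split=> //; first by move=> c x _; apply: has_parity0.
move=> c d x y _ _; have -> : sherm ((0 : H -> H) x) y = 0.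
  by rewrite -[_ x](scale0r 0) shermZl mul0r.
by rewrite -[_ y](scale0r 0) shermZr conjC0 mul0r mulr0.
Qed.

Lemma super_adjoint_add b F F' G G' : adj b F F' -> adj b G G' ->
  adj b (F + G) (F' + G').
Proof.
move=> [Fl Fl' Fb FF'] [Gl Gl' Gb GG']; split; try exact: linear_add.
  exact: op_parityD.
move=> c d x y xc yd; rewrite shermDl shermDr (FF' c d)// (GG' c d)//.
by rewrite -mulrDr.
Qed.

Lemma super_adjoint_scale b k F F' : adj b F F' -> adj b (k *: F) (k^* *: F').
Proof.
move=> [Fl Fl' Fb FF']; split; try exact: linear_scale.
  exact: op_parityZ.
by move=> c d x y xc yd; rewrite shermZl shermZr (FF' c d)// conjCK mulrCA.
Qed.

(** The super adjunction reverses products with the sign of the parities, so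
    it is minus a morphism for the superbracket. *)
Lemma super_adjoint_bracket b c F F' G G' :
  op_parity par b F' -> op_parity par c G' -> adj b F F' -> adj c G G' ->
  adj (b (+) c) (superbracket b c F G) (- superbracket b c F' G').
Proof.
move=> Fb' Gb' [Fl Fl' Fb FF'] [Gl Gl' Gb GG']; split.
- exact: linear_superbracket.
- exact/linear_opp/linear_superbracket.
- by apply: op_parity_superbracket => //; [exact: has_parity0|exact: has_parityP].
move=> d e x y xd ye.
have -> : superbracket b c F G x = F (G x) + - (-1) ^+ (b && c) *: G (F x).
  by rewrite scaleNr.
have -> : (- superbracket b c F' G') y
    = (-1) ^+ (b && c) *: G' (F' y) + (-1) *: F' (G' y).
  by rewrite scaleN1r -opprB.
rewrite shermDl shermDr !shermZl !shermZr.
rewrite (FF' _ _ _ _ (Gb _ _ xd) ye) (GG' _ _ _ _ (Fb _ _ xd) ye).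
rewrite (GG' _ _ _ _ xd (Fb' _ _ ye)) (FF' _ _ _ _ xd (Gb' _ _ ye)).
rewrite conj_sign rmorphN1.
case: b c d {Fb' Gb' FF' Fb GG' Gb xd} => -[] -[]; rewrite /= ?expr0 ?expr1; ring.
Qed.

End FibreSuperAdjoint.

(** * Even and odd parts of smooth forms *)

Section OmegaParity.
Variables (R : realType) (n : nat) (X : oriented_manifold R n).

(** A pullback preserves degrees, since minors with different numbers of rows
    and columns vanish. *)
Lemma local_form_parity_part (b : bool) (a : Defs.form X) e x S :
  local_form (fun p => parity_part b (a p)) e x S =
  if odd #|S| == b then local_form a e x S else 0.
Proof.
rewrite /local_form !ffunE; case: ifP => Sb.
  apply: eq_bigr => T _; rewrite ffunE.
  have [ST|ST] := eqVneq #|S| #|T|; last by rewrite minor_eq0// !mul0r.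
  by rewrite -ST Sb.
apply: big1 => T _; rewrite ffunE.
have [ST|ST] := eqVneq #|S| #|T|; last by rewrite minor_eq0// !mul0r.
by rewrite -ST Sb mulr0.
Qed.

Lemma smooth_parity_part (b : bool) (a : Defs.form X) : smooth_form a ->
  smooth_form (fun p => parity_part b (a p)).
Proof.
move=> sa e S he; rewrite (_ : (fun x => _) =
    if odd #|S| == b then fun x => local_form a e x S : R^o else 0).
  by case: ifP => _; [exact: sa|exact/smooth_on0/chart_cod_open].
by apply/funext => x; rewrite local_form_parity_part; case: ifP.
Qed.

Lemma smooth_complex_parity_part (b : bool) (a : Omega X) :
  (fun p => parity_part b (a p)) \in @smooth_complex_forms _ _ X.
Proof.
case: a => a /=; rewrite !classical_sets.inE => -[ra ia]; split.
  have := smooth_parity_part b ra; congr (smooth_form _); apply/funext => p.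
  by apply/ffunP => S; rewrite !ffunE; case: ifP.
have := smooth_parity_part b ia; congr (smooth_form _); apply/funext => p.
by apply/ffunP => S; rewrite !ffunE; case: ifP.
Qed.

Definition Omega_part b a : Omega X := SmoothForm (smooth_complex_parity_part b a).

Lemma Omega_ext (a b : Omega X) : (forall p, a p = b p) -> a = b.
Proof. by move=> ab; apply: val_inj; apply/funext => p; apply: ab. Qed.

Lemma Omega_parity0 b : Omega_parity b (0 : Omega X).
Proof. by move=> p; apply: has_parity0. Qed.

Lemma Omega_parityP b k (x y : Omega X) :
  Omega_parity b x -> Omega_parity b y -> Omega_parity b (k *: x + y).
Proof. by move=> xb yb p; apply/has_parityD/yb/has_parityZ/xb. Qed.

Lemma Omega_parity_disjoint (x : Omega X) :
  Omega_parity false x -> Omega_parity true x -> x = 0.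
Proof.
move=> x0 x1; apply: Omega_ext => p; apply/ffunP => S; rewrite [RHS]ffunE.
by apply/eqP; apply: contraT => xS; have := x0 p S xS; rewrite (x1 p S xS).
Qed.

Lemma Omega_parity_sum (x : Omega X) : exists x0 x1,
  [/\ Omega_parity false x0, Omega_parity true x1 & x = x0 + x1].
Proof.
exists (Omega_part false x), (Omega_part true x); split=> [p|p|].
- by move=> S; rewrite ffunE; case: ifP => [/eqP|_]; rewrite ?eqxx.
- by move=> S; rewrite ffunE; case: ifP => [/eqP|_]; rewrite ?eqxx.
apply: Omega_ext => p; apply/ffunP => S; rewrite [RHS]ffunE !ffunE.
by case: (odd #|S|); rewrite ?add0r ?addr0.
Qed.

End OmegaParity.

(** * Operators on forms with a super adjoint *)

Section DaggerPairs.
Variables (R : realType) (n : nat) (X : oriented_manifold R n) (g : X -> 'M[R]_n).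
Local Notation W := (Omega X).
Local Notation par := (@has_parity R[i] n).
Implicit Types (phi psi : W -> W) (F : X -> ext R[i] n -> ext R[i] n).

Lemma acts_add phi psi F F' : acts_fibrewise phi F -> acts_fibrewise psi F' ->
  acts_fibrewise (phi + psi) (fun p => F p + F' p).
Proof.
move=> aF aF' a p; change (phi a p + psi a p = F p (a p) + F' p (a p)).
by rewrite aF aF'.
Qed.

Lemma acts_scale c phi F : acts_fibrewise phi F ->
  acts_fibrewise (c *: phi) (fun p => c *: F p).
Proof.
by move=> aF a p; change (c *: phi a p = c *: F p (a p)); rewrite aF.
Qed.

Lemma acts_opp phi F : acts_fibrewise phi F ->
  acts_fibrewise (- phi) (fun p => - F p).
Proof.
by move=> aF a p; change (- phi a p = - F p (a p)); rewrite aF.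
Qed.

Lemma acts_comp phi psi F F' : acts_fibrewise phi F -> acts_fibrewise psi F' ->
  acts_fibrewise (phi \o psi) (fun p => F p \o F' p).
Proof. by move=> aF aF' a p; rewrite /= aF aF'. Qed.

Lemma acts_superbracket b c phi psi F F' :
  acts_fibrewise phi F -> acts_fibrewise psi F' ->
  acts_fibrewise (superbracket b c phi psi) (fun p => superbracket b c (F p) (F' p)).
Proof.
move=> aF aF'; apply: acts_add; first exact: acts_comp.
by apply: acts_opp; apply: acts_scale; apply: acts_comp.
Qed.

Lemma acts_ad3 phi psi F F' : acts_fibrewise phi F -> acts_fibrewise psi F' ->
  acts_fibrewise (ad3 phi psi) (fun p => ad3 (F p) (F' p)).
Proof. by move=> aF aF'; do !apply: acts_superbracket. Qed.

Lemma acts_ext phi F F' : acts_fibrewise phi F -> (forall p, F p = F' p) ->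
  acts_fibrewise phi F'.
Proof. by move=> aF FF' a p; rewrite aF FF'. Qed.

Lemma acts_linear phi F : acts_fibrewise phi F -> (forall p, linear (F p)) ->
  linear phi.
Proof.
move=> aF Fl c x y; apply: Omega_ext => p.
change (phi (c *: x + y) p = c *: phi x p + phi y p).
by rewrite !aF -Fl.
Qed.

Lemma acts_parity b phi F : acts_fibrewise phi F ->
  (forall p, op_parity par b (F p)) -> op_parity (@Omega_parity R n X) b phi.
Proof. by move=> aF Fb c x xc p; rewrite aF; apply/Fb/xc. Qed.

(** The operators F' p are asked to be homogeneous as well: to move a product
    across the form, it is evaluated at values of F' p, and the sign there
    depends on their parity. *)
Definition dagger_pair (b : bool) phi psi := exists F F',
  [/\ acts_fibrewise phi F, acts_fibrewise psi F',
      forall p, homogeneous_super_adjoint (g p) b (F p) (F' p)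
    & forall p, op_parity par b (F' p)].

Lemma dagger_pair_parity b phi psi : dagger_pair b phi psi ->
  op_parity (@Omega_parity R n X) b phi /\ op_parity (@Omega_parity R n X) b psi.
Proof.
move=> [F [F' [aF aF' FF' Fb']]]; split; last exact: acts_parity aF' Fb'.
by apply: acts_parity aF _ => p; have [] := FF' p.
Qed.

Lemma dagger_pair0 b : dagger_pair b 0 0.
Proof.
exists 0, 0; split=> // p; first exact: super_adjoint0.
by move=> c x _; apply: has_parity0.
Qed.

Lemma dagger_pair_add b phi psi phi' psi' :
  dagger_pair b phi psi -> dagger_pair b phi' psi' ->
  dagger_pair b (phi + phi') (psi + psi').
Proof.
move=> [F [F' [aF aF' FF' Fb']]] [G [G' [aG aG' GG' Gb']]].
exists (fun p => F p + G p), (fun p => F' p + G' p).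
split; try exact: acts_add; move=> p; first exact: super_adjoint_add.
exact: op_parityD.
Qed.

Lemma dagger_pair_scale b c phi psi :
  dagger_pair b phi psi -> dagger_pair b (c *: phi) (c^* *: psi).
Proof.
move=> [F [F' [aF aF' FF' Fb']]]; exists (fun p => c *: F p), (fun p => c^* *: F' p).
split; try exact: acts_scale; move=> p; first exact: super_adjoint_scale.
exact: op_parityZ.
Qed.

Lemma dagger_pair_bracket b c phi psi phi' psi' :
  dagger_pair b phi psi -> dagger_pair c phi' psi' ->
  dagger_pair (b (+) c) (superbracket b c phi phi') (- superbracket b c psi psi').
Proof.
move=> [F [F' [aF aF' FF' Fb']]] [G [G' [aG aG' GG' Gb']]].
exists (fun p => superbracket b c (F p) (G p)),
  (fun p => - superbracket b c (F' p) (G' p)).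
split; first exact: acts_superbracket.
- by apply: acts_opp; apply: acts_superbracket.
- by move=> p; apply: super_adjoint_bracket.
move=> p d x xd; apply: has_parityN.
by apply: op_parity_superbracket xd => //; [exact: has_parity0|exact: has_parityP].
Qed.

Lemma dagger_pair_super_adjoint phi0 psi0 phi1 psi1 :
  dagger_pair false phi0 psi0 -> dagger_pair true phi1 psi1 ->
  super_adjoint_of g (phi0 + phi1) (psi0 + psi1).
Proof.
move=> [F [F' [aF aF' FF' Fb']]] [G [G' [aG aG' GG' Gb']]].
exists (fun p => F p + G p), (fun p => F' p + G' p).
split; try exact: acts_add; move=> p.
by exists (F p), (G p), (F' p), (G' p).
Qed.

Definition dagger_stable (L : set (W -> W)) : set (W -> W) :=
  [set phi | exists phi0 phi1 psi0 psi1,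
    [/\ L phi0, L phi1, L psi0, L psi1 &
    [/\ dagger_pair false phi0 psi0, dagger_pair true phi1 psi1
      & phi = phi0 + phi1]]].

Lemma dagger_stable_homogeneous L b phi psi : L 0 -> L phi -> L psi ->
  dagger_pair b phi psi -> dagger_stable L phi.
Proof.
move=> L0 Lphi Lpsi; have d0 := dagger_pair0; case: b => d.
  by exists 0, phi, 0, psi; split=> //; split=> //; rewrite add0r.
by exists phi, 0, psi, 0; split=> //; split=> //; rewrite addr0.
Qed.

(** Closure under brackets: a homogeneous element has only one nonzero
    component, so its bracket is a bracket of elements with known super
    adjoints. *)
Lemma dagger_stable_Lie L :
  Lie_subsuperalgebra (@Omega_parity R n X) (@real_scalars R) L ->
  Lie_subsuperalgebra (@Omega_parity R n X) (@real_scalars R) (dagger_stable L).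
Proof.
move=> LL; have L0 := lie_0 LL; have LD := lie_add LL.
have LN phi : L phi -> L (- phi).
  rewrite -scaleN1r => Lphi; apply: (lie_scale LL) => //.
  by exists (-1) => //; rewrite rmorphN1.
have lin phi : dagger_stable L phi -> linear phi.
  move=> [f0 [f1 [e0 [e1 [Lf0 Lf1 _ _ [_ _ ->]]]]]].
  by apply: linear_add; apply: lie_linear LL _ _.
split=> //.
- exact: dagger_stable_homogeneous (dagger_pair0 false).
- move=> phi psi [f0 [f1 [e0 [e1 [Lf0 Lf1 Le0 Le1 [d0 d1 ->]]]]]].
  move=> [f0' [f1' [e0' [e1' [Lf0' Lf1' Le0' Le1' [d0' d1' ->]]]]]].
  exists (f0 + f0'), (f1 + f1'), (e0 + e0'), (e1 + e1').
  split; try exact: LD; split; try exact: dagger_pair_add.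
  by rewrite addrACA.
- move=> c phi [r _ rc] [f0 [f1 [e0 [e1 [Lf0 Lf1 Le0 Le1 [d0 d1 ->]]]]]].
  have LZ f : L f -> L (c *: f) by apply: (lie_scale LL); exists r.
  have cc : c^* = c by rewrite -rc conj_real.
  exists (c *: f0), (c *: f1), (c *: e0), (c *: e1).
  split; try exact: LZ; split; last by rewrite scalerDr.
    by rewrite -{2}cc; apply: dagger_pair_scale.
  by rewrite -{2}cc; apply: dagger_pair_scale.
- move=> phi [f0 [f1 [e0 [e1 [Lf0 Lf1 Le0 Le1 [d0 d1 ->]]]]]].
  have [p0 _] := dagger_pair_parity d0; have [p1 _] := dagger_pair_parity d1.
  exists f0, f1; split=> //; first exact: dagger_stable_homogeneous d0.
  exact: dagger_stable_homogeneous d1.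
have hom b phi : dagger_stable L phi -> op_parity (@Omega_parity R n X) b phi ->
    exists psi, [/\ L phi, L psi & dagger_pair b phi psi].
  move=> Sphi fb.
  have [f0 [f1 [e0 [e1 [Lf0 Lf1 Le0 Le1 [d0 d1 E]]]]]] := Sphi.
  have [p0 _] := dagger_pair_parity d0; have [p1 _] := dagger_pair_parity d1.
  have := homogeneous_component (@Omega_parity0 _ _ X) (@Omega_parityP _ _ X)
    (@Omega_parity_disjoint _ _ X) (@Omega_parity_sum _ _ X) (lin _ Sphi)
    (lie_linear LL Lf0) (lie_linear LL Lf1) fb p0 p1 E.
  by case: b fb => fb ->; [exists e1 | exists e0].
move=> b c phi psi Sphi Spsi fb ec.
have [phi' [Lphi Lphi' d]] := hom _ _ Sphi fb.
have [psi' [Lpsi Lpsi' e]] := hom _ _ Spsi ec.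
have [_ fb'] := dagger_pair_parity d; have [_ ec'] := dagger_pair_parity e.
apply: dagger_stable_homogeneous (dagger_pair_bracket d e) => //.
  exact: (lie_bracket LL).
by apply: LN; apply: (lie_bracket LL).
Qed.

Lemma dagger_stable_closed L : (L `<=` dagger_stable L)%classic ->
  Lie_subsuperalgebra (@Omega_parity R n X) (@real_scalars R) L ->
  dagger_closed g L /\ dagger_closed g (complexification L).
Proof.
move=> LS LL; have LD := lie_add LL.
have LN phi : L phi -> L (- phi).
  rewrite -scaleN1r => Lphi; apply: (lie_scale LL) => //.
  by exists (-1) => //; rewrite rmorphN1.
split=> phi.
  move=> /LS[f0 [f1 [e0 [e1 [Lf0 Lf1 Le0 Le1 [d0 d1 ->]]]]]].
  by exists (e0 + e1); [exact: LD|exact: dagger_pair_super_adjoint].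
move=> [phi1 [phi2 [/LS L1 /LS L2 ->]]].
have [f0 [f1 [e0 [e1 [Lf0 Lf1 Le0 Le1 [d0 d1 ->]]]]]] := L1.
have [f0' [f1' [e0' [e1' [Lf0' Lf1' Le0' Le1' [d0' d1' ->]]]]]] := L2.
exists ((e0 + e1) + 'i%C *: (- (e0' + e1'))).
  by exists (e0 + e1), (- (e0' + e1')); split=> //; [exact: LD|exact/LN/LD].
rewrite scalerN -scaleNr -conj_i !scalerDr addrACA [in X in _ _ X]addrACA.
by apply: dagger_pair_super_adjoint; apply: dagger_pair_add => //;
  apply: dagger_pair_scale.
Qed.

End DaggerPairs.

(** * Adapted coframes *)

Section Complexification.
Variables (R : realType) (n : nat).
Implicit Types (a b : ext R n) (v : 'rV[R]_n).

Lemma complexify_wedge a b :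
  complexify (wedge a b) = wedge (complexify a) (complexify b).
Proof.
apply/ffunP => S; rewrite !ffunE rmorph_sum; apply: eq_bigr => A _.
by rewrite !ffunE !rmorphM rmorphXn rmorphN1.
Qed.

Lemma complexify_covector v :
  complexify (covector v) = covector (map_mx (real_complex R) v).
Proof.
apply/ffunP => S; rewrite !ffunE rmorph_sum; apply: eq_bigr => i _.
by rewrite mxE.
Qed.

Lemma complexify_sum (I : finType) (f : I -> ext R n) :
  complexify (\sum_i f i) = \sum_i complexify (f i).
Proof.
apply/ffunP => S; rewrite ffunE !sum_ffunE rmorph_sum; apply: eq_bigr => i _.
by rewrite ffunE.
Qed.

Lemma complexify_opp a : complexify (- a) = - complexify a.
Proof. by apply/ffunP => S; rewrite !ffunE rmorphN. Qed.

Lemma covector_opp v : covector (- v) = - covector v.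
Proof.
apply/ffunP => S; rewrite !ffunE -sumrN; apply: eq_bigr => i _.
by rewrite mxE.
Qed.

Lemma wedgeNN a b : wedge (- a) (- b) = wedge a b.
Proof. by rewrite -[- a]scaleN1r wedgeZl linearN scaleN1r opprK. Qed.

End Complexification.

Section AdaptedCoframes.
Variables (R : realType) (g : 'M[R]_9) (w1 w2 wD : ext R 9).
Implicit Types (v : 'I_3 -> 'I_3 -> 'rV[R]_9).
Local Notation adapted := (adapted_coframe g w1 w2 wD).

Definition coframe_matrix v : 'M[R]_9 :=
  \matrix_(r < 9) v (inord (r %% 3)) (inord (r %/ 3)).

Lemma coframe_matrix_orthonormal v : adapted v ->
  coframe_matrix v *m invmx g *m (coframe_matrix v)^T = 1%:M.
Proof.
move=> [vo _ _ _]; apply/matrixP => r s.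
transitivity ((row r (coframe_matrix v) *m invmx g
  *m (row s (coframe_matrix v))^T) 0 0).
  rewrite -row_mul [LHS]mxE [RHS]mxE; apply: eq_bigr => k _.
  by congr (_ * _); rewrite !mxE.
rewrite !rowK vo !mxE; congr ((nat_of_bool _)%:R).
have lt_div (t : 'I_9) : (t %/ 3 < 3)%N by rewrite ltn_divLR.
rewrite -!val_eqE /= !inordK ?ltn_mod//; apply/andP/eqP => [[/eqP m /eqP d]|->//].
by rewrite (divn_eq r 3) (divn_eq s 3) m d.
Qed.

Lemma adapted_unit v : adapted v -> invmx g \in unitmx.
Proof.
move=> /coframe_matrix_orthonormal/mulmx1_unit[].
by rewrite unitmx_mul => /andP[].
Qed.

Lemma adapted_opp v : adapted v -> adapted (fun i j => - v i j).
Proof.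
move=> [vo -> -> ->]; split=> [i j k l|||].
- by rewrite -vo linearN/= mulNmx mulNmx mulmxN opprK.
- by apply: eq_bigr => i _; rewrite !covector_opp wedgeNN.
- by apply: eq_bigr => i _; rewrite !covector_opp wedgeNN.
- by apply: eq_bigr => i _; rewrite !covector_opp wedgeNN.
Qed.

(** In odd dimension 9, changing the sign of every covector changes the
    orientation, while the three forms are quadratic in the coframe. *)
Lemma positive_adapted_coframe v : adapted v ->
  exists v', adapted v' /\ positive_coframe v'.
Proof.
move=> av; have du : \det (coframe_matrix v) != 0.
  have /mulmx1_unit[] := coframe_matrix_orthonormal av.
  by rewrite unitmx_mul unitmxE unitfE => /andP[].
case: ltrgt0P du => // dv _; first by exists v.
exists (fun i j => - v i j); split; first exact: adapted_opp.
rewrite /positive_coframe.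
have -> : \matrix_(r < 9) - v (inord (r %% 3)) (inord (r %/ 3))
    = -1 *: coframe_matrix v.
  by apply/matrixP => r s; rewrite !mxE mulN1r.
by rewrite detZ -signr_odd /= expr1 mulN1r oppr_gt0.
Qed.

Lemma wedge_Vol v j : wedge (complexify (Vol v j)) = V_op v j.
Proof.
apply/funext => x; rewrite /Vol !complexify_wedge !complexify_covector.
by rewrite !wedge_covectorA.
Qed.

Lemma wedge_quadratic v k l x :
  wedge (complexify (\sum_i wedge (covector (v i k)) (covector (v i l)))) x
  = \sum_i cowedge v i k (cowedge v i l x).
Proof.
rewrite complexify_sum wedge_suml; apply: eq_bigr => i _.
by rewrite complexify_wedge !complexify_covector wedge_covectorA.
Qed.

Lemma wedge_L_form v (j : 'I_3) : adapted v ->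
  wedge (complexify (tnth [tuple wD; - w2; w1] j)) = L_op v j.
Proof.
move=> [_ -> -> ->]; apply/funext => x; rewrite /L_op.
have o12 : 1 + 2 = 0 :> 'I_3 by apply: val_inj.
have o21 : 2 + 1 = 0 :> 'I_3 by apply: val_inj.
have o22 : 2 + 2 = 1 :> 'I_3 by apply: val_inj.
have o11 : 1 + 1 = 2 :> 'I_3 by apply: val_inj.
have [->|[->|->]] : j = 0 \/ j = 1 \/ j = 2.
- case: j => -[|[|[|//]]] h; [left|right; left|right; right]; exact: val_inj.
- by rewrite !add0r (tnth_nth 0) wedge_quadratic.
- rewrite o11 o12 (tnth_nth 0)/= complexify_opp -scaleN1r wedgeZl wedge_quadratic.
  rewrite scaler_sumr; apply: eq_bigr => i _.
  by rewrite scaleN1r cowedgeC opprK.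
- by rewrite o21 o22 (tnth_nth 0) wedge_quadratic.
Qed.

End AdaptedCoframes.

(** * Super adjoints of the generators on a fibre *)

Section FibreDaggers.
Variables (R : realType) (n : nat) (g : 'M[R]_n) (v : 'I_3 -> 'I_3 -> 'rV[R]_n).
Local Notation par := (@has_parity R[i] n).
Hypothesis v_orthonormal : forall i j k l,
  (v i j *m invmx g *m (v k l)^T) 0 0 = ((i == k) && (j == l))%:R.
Implicit Types j : 'I_3.

Lemma cowedge_odd i j : op_parity par true (cowedge v i j).
Proof. exact: wedge_covector_odd. Qed.

Lemma cocontract_odd i j : op_parity par true (cocontract g v i j).
Proof. exact: contract_odd. Qed.

Lemma L_op_even j : op_parity par false (L_op v j).
Proof.
move=> c x xc; apply: has_parity_sum => i.
have := @cowedge_odd i (j + 1) _ _ (@cowedge_odd i (j + 2) _ _ xc).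
by case: c {xc}.
Qed.

Lemma Lambda_op_even j : op_parity par false (Lambda_op g v j).
Proof.
move=> c x xc; apply: has_parity_sum => i.
have := @cocontract_odd i (j + 2) _ _ (@cocontract_odd i (j + 1) _ _ xc).
by case: c {xc}.
Qed.

Lemma V_op_odd j : op_parity par true (V_op v j).
Proof.
have o i := @cowedge_odd i j.
exact: (op_parity_comp (o 0) (op_parity_comp (o 1) (o 2))).
Qed.

Lemma Vstar_op_odd j : op_parity par true (Vstar_op g v j).
Proof.
have o i := @cocontract_odd i j.
exact: (op_parity_comp (o 2) (op_parity_comp (o 1) (o 0))).
Qed.

Lemma dagger_L j :
  homogeneous_super_adjoint g false (L_op v j) (Lambda_op g v j).
Proof.
apply: super_adjoint_even; [exact: L_op_linear|exact: Lambda_op_linear|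
  exact: L_op_even|exact: Lambda_op_even|exact: herm_L].
Qed.

Lemma dagger_Lambda j : g^T = g ->
  homogeneous_super_adjoint g false (Lambda_op g v j) (L_op v j).
Proof.
move=> gs; apply: super_adjoint_even; [exact: Lambda_op_linear|exact: L_op_linear|
  exact: Lambda_op_even|exact: L_op_even|move=> x y].
by rewrite (herm_conj _ _ gs) -herm_L -(herm_conj _ _ gs).
Qed.

(** The sign makes this the star, rather than the ordinary adjoint, of V_j. *)
Definition A_op j := @degree_sign R n 3 \o Vstar_op g v j.

Lemma A_op_linear j : linear (A_op j).
Proof.
by apply: linear_comp; [exact: degree_sign_linear|exact: Vstar_op_linear].
Qed.

Lemma A_op_odd j : op_parity par true (A_op j).
Proof. exact: (op_parity_comp (@degree_sign_parity _ _ 3) (@Vstar_op_odd j)). Qed.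

(** The operator on the right is - Vstar_op (j + 1), written as an element of
    the real algebra generated by the i V and i Lambda. *)
Lemma dagger_V j : homogeneous_super_adjoint g true ('i%C *: V_op v (j + 1))
  (- (6%:R^-1)%:C%C *: ad3 ('i%C *: Lambda_op g v (j + 2)) ('i%C *: V_op v j)).
Proof.
rewrite (ad3Z _ _ (@V_op_linear _ _ _ _) (@Lambda_op_linear _ _ _ _ _)).
rewrite ad3_Lambda_V// -exprS !scalerA.
have -> : - (6%:R^-1)%:C%C * 'i%C ^+ 4 * 6%:R = - 1 :> R[i].
  have -> : ('i%C : R[i]) ^+ 4 = 1.
    by rewrite (exprM _ 2 2) sqr_i sqrrN expr1n.
  by rewrite fmorphV rmorph_nat; field.
have -> : - 1 = ('i%C)^* * - 'i%C :> R[i] by rewrite conj_i mulrNN -expr2 sqr_i.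
rewrite -scalerA; apply: super_adjoint_scale; apply: super_adjoint_odd.
- exact: V_op_linear.
- exact: Vstar_op_linear.
- exact: V_op_odd.
- exact: Vstar_op_odd.
- exact: herm_V.
Qed.

(** The operator on the right is i eps V_op (j + 1), where eps is the sign of
    the degree, written as an element of the real algebra generated by the A
    and i L. *)
Lemma dagger_A j : g^T = g -> homogeneous_super_adjoint g true (A_op (j + 1))
  ((6%:R^-1)%:C%C *: ad3 ('i%C *: L_op v (j + 2)) (A_op j)).
Proof.
move=> gs; have sl := @degree_sign_linear R n 3.
have sL x : degree_sign 3 (L_op v (j + 2) x) = L_op v (j + 2) (degree_sign 3 x).
  by rewrite (degree_sign_op _ _ (@L_op_linear _ _ _ _) (@L_op_even _)) // scale1r.
have := @ad3Z _ _ 1 'i%C _ _ (@A_op_linear j) (@L_op_linear _ _ v (j + 2)).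
rewrite scale1r mul1r => ->.
rewrite (ad3_comp _ sl sL) ad3_L_Vstar//.
have -> : (6%:R^-1)%:C%C *: ('i%C ^+ 3 *: (degree_sign 3 \o (- 6%:R *: V_op v (j + 1))))
    = - 'i%C *: (V_op v (j + 1) \o degree_sign 3).
  apply/funext => x; rewrite !fctE /= (linZ _ sl).
  rewrite (degree_sign_op _ _ (@V_op_linear _ _ _ _) (@V_op_odd _)) // expr1 !scalerA.
  congr (_ *: _); rewrite exprS sqr_i.
  by rewrite fmorphV rmorph_nat; field.
apply: super_adjoint_odd.
- exact: A_op_linear.
- by apply: linear_comp; [exact: V_op_linear|exact: sl].
- exact: A_op_odd.
- exact: (op_parity_comp (@V_op_odd _) (@degree_sign_parity _ _ 3)).
- move=> x y; rewrite /A_op /= herm_degree_sign.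
  by rewrite (herm_conj _ _ gs) -herm_V -(herm_conj _ _ gs).
Qed.

End FibreDaggers.

(** * The Lie superalgebra of a WSD manifold *)

Section WSDOperators.
Variables (R : realType) (X : WSD3_manifold R).
Variables (L V Lam A : 'I_3 -> Omega X -> Omega X).
Hypothesis hops : WSD_operators L V Lam A.
Local Notation W := (Omega X).
Local Notation L3 := (L3 L V Lam A).
Local Notation oparity := (op_parity (@Omega_parity R 9 X)).

Definition coframe_at (p : X) : 'I_3 -> 'I_3 -> 'rV[R]_9 :=
  xget (fun _ _ => 0) [set v |
    adapted_coframe (metric p) (omega1 p) (omega2 p) (omegaD p) v
    /\ positive_coframe v].

Lemma coframe_at_adapted p :
  adapted_coframe (metric p) (omega1 p) (omega2 p) (omegaD p) (coframe_at p).
Proof.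
have [v /positive_adapted_coframe[v' v'P]] := WSD_coframe p.
by rewrite /coframe_at; case: xgetP => [w _ []//|/(_ v')/(_ v'P)].
Qed.

Lemma coframe_at_orthonormal p i j k l :
  (coframe_at p i j *m invmx (metric p) *m (coframe_at p k l)^T) 0 0
  = ((i == k) && (j == l))%:R.
Proof. by have [] := coframe_at_adapted p. Qed.

Lemma metric_trmx (p : X) : (metric p)^T = metric p.
Proof. exact: (Defs.metric_sym (metric_riemannian X)). Qed.

Lemma L_acts j : acts_fibrewise (L j) (fun p => L_op (coframe_at p) j).
Proof.
apply: acts_ext (op_L hops j) _ => p.
exact: wedge_L_form (coframe_at_adapted p).
Qed.

Lemma V_acts j : acts_fibrewise (V j) (fun p => V_op (coframe_at p) j).
Proof. by apply: acts_ext (op_V hops j) _ => p; rewrite wedge_Vol. Qed.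

Lemma Lam_acts j :
  acts_fibrewise (Lam j) (fun p => Lambda_op (metric p) (coframe_at p) j).
Proof.
have [F' aF' FF'] := op_Lam hops j; apply: acts_ext aF' _ => p.
have := FF' p; rewrite (wedge_L_form _ (coframe_at_adapted p)).
move=> /(star_adjointE (adapted_unit (coframe_at_adapted p))
  (@Lambda_op_linear _ _ _ _ _) (@herm_L _ _ _ _ _)) ->.
by apply/funext => x /=; rewrite degree_sign_even.
Qed.

Lemma A_acts j : acts_fibrewise (A j) (fun p => A_op (metric p) (coframe_at p) j).
Proof.
have [F' aF' FF'] := op_A hops j; apply: acts_ext aF' _ => p.
have := FF' p; rewrite /VolW wedge_Vol.
by move=> /(star_adjointE (adapted_unit (coframe_at_adapted p))
  (@Vstar_op_linear _ _ _ _ _) (@herm_V _ _ _ _ _)) ->.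
Qed.

Definition generators : set (W -> W) := [set phi | exists j : 'I_3,
  [\/ phi = 'i%C *: L j, phi = 'i%C *: V j, phi = 'i%C *: Lam j | phi = A j]].

Lemma L_even j : linear (L j) /\ oparity false (L j).
Proof.
split; first by apply: acts_linear (L_acts j) _ => p; apply: L_op_linear.
by apply: acts_parity (L_acts j) _ => p; apply: L_op_even.
Qed.

Lemma Lam_even j : linear (Lam j) /\ oparity false (Lam j).
Proof.
split; first by apply: acts_linear (Lam_acts j) _ => p; apply: Lambda_op_linear.
by apply: acts_parity (Lam_acts j) _ => p; apply: Lambda_op_even.
Qed.

Lemma V_odd j : linear (V j) /\ oparity true (V j).
Proof.
split; first by apply: acts_linear (V_acts j) _ => p; apply: V_op_linear.
by apply: acts_parity (V_acts j) _ => p; apply: V_op_odd.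
Qed.

Lemma A_odd j : linear (A j) /\ oparity true (A j).
Proof.
split; first by apply: acts_linear (A_acts j) _ => p; apply: A_op_linear.
by apply: acts_parity (A_acts j) _ => p; apply: A_op_odd.
Qed.

Lemma oparity_scale b c (phi : W -> W) : oparity b phi -> oparity b (c *: phi).
Proof.
by apply: op_parity_scale; [exact: Omega_parity0|exact: Omega_parityP].
Qed.

Lemma L3_Lie : Lie_subsuperalgebra (@Omega_parity R 9 X) (@real_scalars R) L3.
Proof.
apply: smallest_Lie; [exact: Omega_parity0|exact: Omega_parityP|
  exact: Omega_parity_disjoint|exact: Omega_parity_sum|].
have hom b (phi : W -> W) : linear phi /\ oparity b phi ->
    graded_operators (@Omega_parity R 9 X) phi.
  by case; apply: graded_homogeneous; exact: Omega_parity0.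
have homi b (phi : W -> W) : linear phi /\ oparity b phi ->
    graded_operators (@Omega_parity R 9 X) ('i%C *: phi).
  by move=> [fl fb]; apply: (hom b); split;
    [exact: linear_scale|exact: oparity_scale].
move=> phi [j [->|->|->|->]].
- exact: homi (L_even j).
- exact: homi (V_odd j).
- exact: homi (Lam_even j).
- exact: hom (A_odd j).
Qed.

Lemma L3_generators phi : generators phi -> L3 phi.
Proof. by move=> gphi B [_]; apply. Qed.

Lemma L3_iL j : L3 ('i%C *: L j).
Proof. by apply: L3_generators; exists j; constructor 1. Qed.

Lemma L3_iV j : L3 ('i%C *: V j).
Proof. by apply: L3_generators; exists j; constructor 2. Qed.

Lemma L3_iLam j : L3 ('i%C *: Lam j).
Proof. by apply: L3_generators; exists j; constructor 3. Qed.

Lemma L3_A j : L3 (A j).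
Proof. by apply: L3_generators; exists j; constructor 4. Qed.

Lemma L3_scale (r : R) phi : L3 phi -> L3 (r%:C%C *: phi).
Proof. by apply: (lie_scale L3_Lie); exists r. Qed.

Lemma L3_ad3 phi psi : L3 phi -> oparity true phi -> L3 psi -> oparity false psi ->
  L3 (ad3 psi phi).
Proof.
move=> Lphi ophi Lpsi epsi.
have o0 := @Omega_parity0 R 9 X; have oP := @Omega_parityP R 9 X.
have odd (f : W -> W) : oparity true f ->
    oparity true (superbracket true false f psi).
  by move=> /(op_parity_superbracket o0 oP)/(_ epsi).
have bracket (f : W -> W) : L3 f -> oparity true f ->
    L3 (superbracket true false f psi).
  by move=> Lf fo; apply: (lie_bracket L3_Lie).
have o1 := odd _ ophi; have o2 := odd _ o1.
by apply: (bracket) => //; apply: (bracket) => //; apply: (bracket).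
Qed.

Lemma L3_stable : L3 `<=` dagger_stable (@metric R X) L3.
Proof.
have L0 := lie_0 L3_Lie; have on := coframe_at_orthonormal.
have ad3_odd := @op_parity_ad3 _ _ (@has_parity R[i] 9) (@has_parity0 _ _)
  (@has_parityP _ _).
have stable b phi psi := @dagger_stable_homogeneous _ _ _ (@metric R X) L3 b phi psi L0.
have Lam_L j : L3 (- 'i%C *: L j).
  by have := L3_scale (-1) (L3_iL j); rewrite rmorphN1 scalerA mulN1r.
have L_Lam j : L3 (- 'i%C *: Lam j).
  by have := L3_scale (-1) (L3_iLam j); rewrite rmorphN1 scalerA mulN1r.
move=> phi; apply; split; first exact: dagger_stable_Lie L3_Lie.
have [oV oA] := (fun j => (V_odd j).2, fun j => (A_odd j).2).
move=> {}phi [j [->|->|->|->]].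
- apply: (stable false _ (- 'i%C *: Lam j)) => //; first exact: L3_iL.
  rewrite -conj_i; apply: dagger_pair_scale.
  exists (fun p => L_op (coframe_at p) j),
    (fun p => Lambda_op (metric p) (coframe_at p) j).
  split; [exact: L_acts|exact: Lam_acts| |] => p; first exact: dagger_L.
  exact: Lambda_op_even.
- rewrite -[j]ord3D21; set k := j + 2.
  apply: (stable true _ (- (6%:R^-1)%:C%C *: ad3 ('i%C *: Lam (k + 2)) ('i%C *: V k))).
  + exact: L3_iV.
  + rewrite -rmorphN; apply: L3_scale; apply: L3_ad3; try exact: L3_iV;
      try exact: L3_iLam; apply: oparity_scale; first exact: oV.
    by have [] := Lam_even (k + 2).
  + set F := fun p => 'i%C *: V_op (coframe_at p) (k + 1).
    exists F, (fun p => - (6%:R^-1)%:C%C *: ad3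
      ('i%C *: Lambda_op (metric p) (coframe_at p) (k + 2))
      ('i%C *: V_op (coframe_at p) k)).
    split.
    * exact/acts_scale/V_acts.
    * by apply/acts_scale/acts_ad3; apply: acts_scale; [exact: Lam_acts|exact: V_acts].
    * by move=> p; apply: dagger_V.
    * move=> p; apply: op_parityZ; apply: ad3_odd; apply: op_parityZ.
        exact: V_op_odd.
      exact: Lambda_op_even.
- apply: (stable false _ (- 'i%C *: L j)) => //; first exact: L3_iLam.
  rewrite -conj_i; apply: dagger_pair_scale.
  exists (fun p => Lambda_op (metric p) (coframe_at p) j),
    (fun p => L_op (coframe_at p) j).
  split; [exact: Lam_acts|exact: L_acts| |] => p.
    exact/dagger_Lambda/metric_trmx.
  exact: L_op_even.
- rewrite -[j]ord3D21; set k := j + 2.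
  apply: (stable true _ ((6%:R^-1)%:C%C *: ad3 ('i%C *: L (k + 2)) (A k))).
  + exact: L3_A.
  + apply: L3_scale; apply: L3_ad3; [exact: L3_A|exact: oA|exact: L3_iL|].
    by apply: oparity_scale; have [] := L_even (k + 2).
  + exists (fun p => A_op (metric p) (coframe_at p) (k + 1)),
      (fun p => (6%:R^-1)%:C%C *: ad3 ('i%C *: L_op (coframe_at p) (k + 2))
         (A_op (metric p) (coframe_at p) k)).
    split.
    * exact: A_acts.
    * by apply/acts_scale/acts_ad3; [exact/acts_scale/L_acts|exact: A_acts].
    * by move=> p; apply: dagger_A => //; apply: metric_trmx.
    * move=> p; apply: op_parityZ; apply: ad3_odd; first exact: A_op_odd.
      by apply: op_parityZ; apply: L_op_even.
Qed.

End WSDOperators.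

Theorem mainTheorem5 (R : realType) (X : WSD3_manifold R)
    (L V Lam A : 'I_3 -> Omega X -> Omega X)
    (hops : WSD_operators L V Lam A) :
  [/\ dagger_closed (@metric R X) (L3 L V Lam A),
      dagger_closed (@metric R X) (L3C L V Lam A)
    & star_Lie_superalgebra (@metric R X) (L3C L V Lam A)].
Proof.
have LL := L3_Lie hops.
have [dL dLC] := dagger_stable_closed (L3_stable hops) LL.
split=> //; split=> //.
apply: complexification_Lie LL; [exact: Omega_parity0|exact: Omega_parityP|
  exact: Omega_parity_disjoint|exact: Omega_parity_sum].
Qed.
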